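(* Let $\mathbb{F}$ be a field of characteristic $\neq 2,3$, let $\mathsf{V}$ be a $3$-dimensional vector space over $\mathbb{F}$, let $\mathsf{A},\mathsf{B},\mathsf{C},\mathfrak{s}$ be vector spaces over $\mathbb{F}$, and let $$\mathcal{L}=\bigl(\mathfrak{sl}(\mathsf{V})\otimes \mathsf{A}\bigr)\oplus\bigl(\mathsf{V}\otimes \mathsf{B}\bigr)\oplus\bigl(\mathsf{V}^*\otimes \mathsf{C}\bigr)\oplus\mathfrak{s}.$$ Suppose given bilinear maps - $\mathsf{A}\times\mathsf{A}\to\mathsf{A}$, $(a,a')\mapsto a\circ a'$, commutative; - $\mathsf{A}\times\mathsf{A}\to\mathsf{A}$, $(a,a')\mapsto [a,a']$, anticommutative; - $\mathsf{A}\times\mathsf{A}\to\mathfrak{s}$, $(a,a')\mapsto D_{a,a'}$, skew-symmetric; - $\mathsf{A}\times\mathsf{B}\to\mathsf{B}$, $(a,b)\mapsto ab$; - $\mathsf{C}\times\mathsf{A}\to\mathsf{C}$, $(c,a)\mapsto ca$; - $\mathsf{B}\times\mathsf{C}\to\mathsf{A}$, $(b,c)\mapsto T(b,c)$; - $\mathsf{B}\times\mathsf{C}\to\mathfrak{s}$, $(b,c)\mapsto D_{b,c}$; - $\mathsf{B}\times\mathsf{B}\to\mathsf{C}$, $(b_1,b_2)\mapsto b_1\times b_2$, symmetric; - $\mathsf{C}\times\mathsf{C}\to\mathsf{B}$, $(c_1,c_2)\mapsto c_1\times c_2$, symmetric; - $\mathfrak{s}\times\mathsf{A}\to\mathsf{A}$,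 $\mathfrak{s}\times\mathsf{B}\to\mathsf{B}$, $\mathfrak{s}\times\mathsf{C}\to\mathsf{C}$, denoted $(d,a)\mapsto da$, $(d,b)\mapsto db$, $(d,c)\mapsto dc$; and an anticommutative bilinear bracket $\mathfrak{s}\times\mathfrak{s}\to\mathfrak{s}$. Suppose also that $\mathsf{A}$ contains a distinguished element $1$ with $1\circ a=2a$, $[1,a]=0$, $D_{1,a}=0$, $1b=b$, $c1=c$ and $d1=0$ for all $a\in\mathsf{A}$, $b\in\mathsf{B}$, $c\in\mathsf{C}$, $d\in\mathfrak{s}$. Define an anticommutative bracket on $\mathcal{L}$, extending the bracket of $\mathfrak{s}$, by $$\begin{aligned} [x\otimes a,y\otimes a']&=[x,y]\otimes \tfrac{1}{2}\,a\circ a' + (x\circ y)\otimes \tfrac{1}{2} [a,a']+(x\vert y)D_{a,a'},\\ [x\otimes a,u\otimes b]&=xu\otimes ab,\\ [v^*\otimes c,x\otimes a]&=v^*x\otimes ca,\\ [u\otimes b,v^*\otimes c]&=\bigl(uv^*-\tfrac{1}{3}(v^*u)\mathsf{I}_3\bigr)\otimes T(b,c)+\tfrac{1}{3}(v^*u)D_{b,c},\\ [u_1\otimes b_1,u_2\otimes b_2]&= (u_1\wedge u_2) \otimes (b_1\times b_2),\\ [v_1^*\otimes c_1,v_2^*\otimes c_2]&= (v_1^*\wedge v_2^* ) \otimes (c_1\times c_2),\\ [d,x\otimes a]&=x\otimes da,\quad [d,u\otimes b]=u\otimes db,\quad [d,v^*\otimes c]=v^*\otimes dc, \end{aligned}$$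 for $x,y\in\mathfrak{sl}(\mathsf{V})$, $u,u_1,u_2\in\mathsf{V}$, $v^*,v_1^*,v_2^*\in\mathsf{V}^*$, $d\in\mathfrak{s}$, $a,a'\in\mathsf{A}$, $b,b_1,b_2\in\mathsf{B}$, $c,c_1,c_2\in\mathsf{C}$. Then $\mathcal{L}$ is a Lie algebra if and only if the following conditions are all satisfied: (0) $\mathfrak{s}$ is a Lie subalgebra of $\mathcal{L}$; $\mathsf{A},\mathsf{B},\mathsf{C}$ are modules for $\mathfrak{s}$ relative to the given actions; and the bilinear maps $a\circ a'$, $[a,a']$, $D_{a,a'}$, $ab$, $ca$, $T(b,c)$, $D_{b,c}$, $b_1\times b_2$, $c_1\times c_2$ above are $\mathfrak{s}$-invariant. (1) $\mathsf{A}$ is an alternative algebra relative to the multiplication $aa'=\frac12 a\circ a'+\frac12[a,a']$, and for all $a_1,a_2,a_3\in\mathsf{A}$ $$D_{a_1,a_2a_3}+D_{a_2,a_3a_1}+D_{a_3,a_1a_2}=0,\qquad D_{a_1,a_2}a_3=[[a_1,a_2],a_3]+3\bigl((a_1a_3)a_2-a_1(a_3a_2)\bigr).$$ (2) For all $a_1,a_2\in\mathsf{A}$, $b\in\mathsf{B}$, $c\in\mathsf{C}$: $a_1(a_2b)=(a_1a_2)b$ and $(ca_1)a_2=c(a_1a_2)$ (so that $\mathsf{B}$ is a left associative module and $\mathsf{C}$ a right associative module for $\mathsf{A}$), and $D_{a_1,a_2}b=[a_1,a_2]b$, $D_{a_1,a_2}c=c[a_2,a_1]$. (3) For all $a\in\mathsf{A}$,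 $b\in\mathsf{B}$, $c\in\mathsf{C}$: $aT(b,c)=T(ab,c)$, $T(b,c)a=T(b,ca)$, $D_{a,T(b,c)}=D_{ab,c}-D_{b,ca}$, and $D_{b,c}a=[T(b,c),a]$. (4) For all $a\in\mathsf{A}$, $b_1,b_2\in\mathsf{B}$, $c_1,c_2\in\mathsf{C}$: $(b_1\times b_2)a=(ab_1)\times b_2=b_1\times(ab_2)$ and $a(c_1\times c_2)=(c_1a)\times c_2=c_1\times(c_2a)$. (5) $D_{b,b\times b}=0$ for all $b\in\mathsf{B}$ and $D_{c\times c,c}=0$ for all $c\in\mathsf{C}$; in addition, the trilinear maps $\mathsf{B}\times\mathsf{B}\times\mathsf{B}\to\mathsf{A}$, $(b_1,b_2,b_3)\mapsto T(b_1,b_2\times b_3)$, and $\mathsf{C}\times\mathsf{C}\times\mathsf{C}\to\mathsf{A}$, $(c_1,c_2,c_3)\mapsto T(c_1\times c_2,c_3)$, are symmetric. (6) For all $b,b_1,b_2\in\mathsf{B}$ and $c,c_1,c_2\in\mathsf{C}$: $$\begin{aligned} (b_1\times b_2)\times c&=-\tfrac13T(b_1,c)b_2+\tfrac13D_{b_1,c}b_2-T(b_2,c)b_1,\\ b\times(c_1\times c_2)&=-c_2T(b,c_1)-\tfrac13c_1T(b,c_2)-\tfrac13D_{b,c_2}c_1. \end{aligned}$$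
   Context: Notation: $\mathfrak{sl}(\mathsf{V})$ is the Lie algebra of trace-zero endomorphisms of $\mathsf{V}$, and $\mathsf{I}_3$ is the identity map of $\mathsf{V}$. For $x,y\in\mathfrak{sl}(\mathsf{V})$: $[x,y]=xy-yx$, $x\circ y=xy+yx-\frac23\operatorname{tr}(xy)\mathsf{I}_3$, $(x\vert y)=\frac13\operatorname{tr}(xy)$. For $u\in\mathsf{V}$, $v^*\in\mathsf{V}^*$: $xu=x(u)$; $v^*x=v^*\circ x\in\mathsf{V}^*$ (composition); $v^*u=v^*(u)\in\mathbb{F}$; $uv^*$ is the endomorphism $w\mapsto v^*(w)u$ of $\mathsf{V}$. Fix a nonzero linear map $\det:\bigwedge^3\mathsf{V}\to\mathbb{F}$. It determines a linear map $\det:\bigwedge^3\mathsf{V}^*\to\mathbb{F}$ such that $\det(f_1\wedge f_2\wedge f_3)\det(v_1\wedge v_2\wedge v_3)$ equals the usual determinant of the $3\times3$ matrix $(f_i(v_j))$, for all $f_i\in\mathsf{V}^*$, $v_j\in\mathsf{V}$. Identify $\bigwedge^2\mathsf{V}$ with $\mathsf{V}^*$ by $u_1\wedge u_2\leftrightarrow\det(u_1\wedge u_2\wedge\,\cdot\,)$, and likewise $\bigwedge^2\mathsf{V}^*$ with $\mathsf{V}$ (i.e. $f_1\wedge f_2$ is the vector $w\in\mathsf{V}$ with $f(w)=\det(f_1\wedge f_2\wedge f)$ for all $f\in\mathsf{V}^*$). The symbol $D$ denotes both maps $\mathsf{A}\times\mathsf{A}\to\mathfrak{s}$ and $\mathsf{B}\times\mathsf{C}\to\mathfrak{s}$;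 which is meant is clear from the subscripts. A bilinear map $\beta$ between $\mathfrak{s}$-modules is $\mathfrak{s}$-invariant if $d\,\beta(p,q)=\beta(dp,q)+\beta(p,dq)$ for all $d\in\mathfrak{s}$, where $\mathfrak{s}$ acts on itself by the adjoint action. An algebra is alternative if $(xx)y=x(xy)$ and $(yx)x=y(xx)$ for all $x,y$. *)

(* Defs.v *)
From HB Require Import structures.
From mathcomp Require Import all_boot all_algebra.
From mathcomp Require Import boolp ring.

Set Implicit Arguments.
Unset Strict Implicit.
Unset Printing Implicit Defensive.

Import GRing.Theory.
Local Open Scope ring_scope.
Local Open Scope quotient_scope.

Definition is_bilinear (F : fieldType) (U W Z : lmodType F) (f : U -> W -> Z) : Prop :=
  (forall w, linear (f^~ w)) /\ (forall u, linear (f u)).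

(* The tensor product U (x) W over F. A list of pairs (u_k, w_k) stands for
   the sum of the u_k (x) w_k (scalars are absorbed in the u_k); two lists are
   identified when every bilinear map takes the same value on them. The
   universal property is tensor_lift_pure, tensor_lift_linear and tensor_ext. *)
Section Tensor.
Variables (F : fieldType) (U W : lmodType F).

Definition formal_eval (Z : lmodType F) (f : U -> W -> Z) (t : seq (U * W)) : Z :=
  \sum_(p <- t) f p.1 p.2.

Definition formal_equiv (t1 t2 : seq (U * W)) : Prop :=
  forall (Z : lmodType F) (f : U -> W -> Z),
    is_bilinear f -> formal_eval f t1 = formal_eval f t2.

Definition formal_equivb (t1 t2 : seq (U * W)) : bool := `[< formal_equiv t1 t2 >].

Lemma formal_equivb_refl : reflexive formal_equivb.
Proof. by move=> t; apply/asboolP. Qed.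

Lemma formal_equivb_sym : symmetric formal_equivb.
Proof.
by move=> t1 t2; apply/asboolP/asboolP => E Z f bf; rewrite (E Z f bf).
Qed.

Lemma formal_equivb_trans : transitive formal_equivb.
Proof.
move=> t2 t1 t3 /asboolP E1 /asboolP E2; apply/asboolP => Z f bf.
by rewrite (E1 Z f bf) (E2 Z f bf).
Qed.

Canonical formal_equiv_rel :=
  EquivRel formal_equivb formal_equivb_refl formal_equivb_sym formal_equivb_trans.

Definition tensor := {eq_quot formal_equiv_rel}.
HB.instance Definition _ := Choice.on tensor.
HB.instance Definition _ := Quotient.on tensor.
HB.instance Definition _ := EqQuotient.on tensor.

Definition pure (u : U) (w : W) : tensor := \pi_tensor [:: (u, w)].

Definition tensor_lift (Z : lmodType F) (f : U -> W -> Z) (t : tensor) : Z :=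
  formal_eval f (repr t).

Lemma tensor_lift_pi (Z : lmodType F) (f : U -> W -> Z) l :
  is_bilinear f -> tensor_lift f (\pi_tensor l) = formal_eval f l.
Proof.
move=> bf; have /eqmodP/asboolP E : repr (\pi_tensor l) = l %[mod tensor].
  by rewrite reprK.
exact: E.
Qed.

Lemma tensor_eqP (t1 t2 : tensor) :
  (forall (Z : lmodType F) (f : U -> W -> Z), is_bilinear f ->
     tensor_lift f t1 = tensor_lift f t2) -> t1 = t2.
Proof. by move=> E; rewrite -[t1]reprK -[t2]reprK; apply/eqmodP/asboolP. Qed.

Definition tensor_zero : tensor := \pi_tensor [::].
Definition tensor_add (t1 t2 : tensor) : tensor := \pi_tensor (repr t1 ++ repr t2).
Definition tensor_scale (k : F) (t : tensor) : tensor :=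
  \pi_tensor [seq (k *: p.1, p.2) | p <- repr t].
Definition tensor_opp : tensor -> tensor := tensor_scale (- 1).

Section LiftMorphism.
Variables (Z : lmodType F) (f : U -> W -> Z).
Hypothesis bf : is_bilinear f.

Lemma tensor_lift0 : tensor_lift f tensor_zero = 0.
Proof. by rewrite tensor_lift_pi // /formal_eval big_nil. Qed.

Lemma tensor_liftD t1 t2 :
  tensor_lift f (tensor_add t1 t2) = tensor_lift f t1 + tensor_lift f t2.
Proof. by rewrite tensor_lift_pi // /formal_eval big_cat. Qed.

Lemma tensor_liftZ k t : tensor_lift f (tensor_scale k t) = k *: tensor_lift f t.
Proof.
rewrite tensor_lift_pi // /formal_eval big_map scaler_sumr.
apply: eq_bigr => -[u w] _ /=.
have := bf.1 w k u 0; rewrite addr0 => ->.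
by have := bf.1 w (-1) 0 0; rewrite scaler0 addr0 scaleN1r addNr => ->; rewrite addr0.
Qed.

Lemma tensor_liftN t : tensor_lift f (tensor_opp t) = - tensor_lift f t.
Proof. by rewrite /tensor_opp tensor_liftZ scaleN1r. Qed.
End LiftMorphism.

Let tensor_liftE := (tensor_liftD, tensor_liftN, tensor_liftZ, tensor_lift0).

Lemma tensor_addA : associative tensor_add.
Proof. by move=> x y z; apply: tensor_eqP => Z f bf; rewrite !tensor_liftE // addrA. Qed.
Lemma tensor_addC : commutative tensor_add.
Proof. by move=> x y; apply: tensor_eqP => Z f bf; rewrite !tensor_liftE // addrC. Qed.
Lemma tensor_add0 : left_id tensor_zero tensor_add.
Proof. by move=> x; apply: tensor_eqP => Z f bf; rewrite !tensor_liftE // add0r. Qed.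
Lemma tensor_addN : left_inverse tensor_zero tensor_opp tensor_add.
Proof. by move=> x; apply: tensor_eqP => Z f bf; rewrite !tensor_liftE // addNr. Qed.

HB.instance Definition _ :=
  GRing.isZmodule.Build tensor tensor_addA tensor_addC tensor_add0 tensor_addN.

Lemma tensor_scaleA k l t : tensor_scale k (tensor_scale l t) = tensor_scale (k * l) t.
Proof. by apply: tensor_eqP => Z f bf; rewrite !tensor_liftE // scalerA. Qed.
Lemma tensor_scale1 : left_id 1 tensor_scale.
Proof. by move=> t; apply: tensor_eqP => Z f bf; rewrite !tensor_liftE // scale1r. Qed.
Lemma tensor_scaleDr : right_distributive tensor_scale +%R.
Proof. by move=> k x y; apply: tensor_eqP => Z f bf; rewrite !tensor_liftE // scalerDr. Qed.
Lemma tensor_scaleDl t : {morph tensor_scale^~ t : k l / k + l}.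
Proof. by move=> k l; apply: tensor_eqP => Z f bf; rewrite !tensor_liftE // scalerDl. Qed.

HB.instance Definition _ := GRing.Zmodule_isLmodule.Build F tensor
  tensor_scaleA tensor_scale1 tensor_scaleDr tensor_scaleDl.

Lemma tensor_lift_linear (Z : lmodType F) (f : U -> W -> Z) :
  is_bilinear f -> linear (tensor_lift f).
Proof. by move=> bf k x y; rewrite tensor_liftD // tensor_liftZ. Qed.

Lemma tensor_lift_pure (Z : lmodType F) (f : U -> W -> Z) u w :
  is_bilinear f -> tensor_lift f (pure u w) = f u w.
Proof. by move=> bf; rewrite tensor_lift_pi // /formal_eval big_seq1. Qed.

Lemma pure_bilinear : is_bilinear pure.
Proof.
split=> [w k u1 u2|u k w1 w2]; apply: tensor_eqP => Z f bf;
  rewrite tensor_lift_linear // !tensor_lift_pure //; [exact: bf.1|exact: bf.2].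
Qed.

Lemma tensor_spanned (t : tensor) :
  exists l : seq (U * W), t = \sum_(p <- l) pure p.1 p.2.
Proof.
exists (repr t); apply: tensor_eqP => Z f bf.
have lin := tensor_lift_linear bf.
rewrite {1}/tensor_lift /formal_eval; elim: (repr t) => [|p l IH].
  by rewrite !big_nil tensor_lift0.
by rewrite !big_cons IH tensor_liftD // tensor_lift_pure.
Qed.

Lemma tensor_ext (Z : lmodType F) (g h : {linear tensor -> Z}) :
  (forall u w, g (pure u w) = h (pure u w)) -> g =1 h.
Proof.
move=> E t; have [l ->] := tensor_spanned t.
by rewrite !linear_sum; apply: eq_bigr => p _.
Qed.

End Tensor.

Arguments pure {F U W} u w.
Arguments tensor_lift {F U W Z} f t.

Definition tensor_lift2 (F : fieldType) (U W U' W' Z : lmodType F)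
    (f : U -> W -> U' -> W' -> Z) (t : tensor U W) (t' : tensor U' W') : Z :=
  tensor_lift (fun u w => tensor_lift (f u w) t') t.

Section Endomorphisms.
Variables (F : fieldType) (V : vectType F).
Implicit Types (x y : 'End(V)).

Definition endo_tr x : F := \tr (passmx.mxof (vbasis {:V}) (vbasis {:V}) x).

Definition sl : {vspace 'End(V)} := lker (linfun (endo_tr : 'End(V) -> F^o)).

Definition dual := 'Hom(V, F^o).

(* The endomorphism u v^* : w |-> v^*(w) u *)
Definition rank1 (u : V) (v : dual) : 'End(V) := linfun (fun w => (v w : F) *: u).

Lemma linfunE (Z : vectType F) (f : V -> Z) : linear f -> linfun f =1 f.
Proof.
move=> lf; pose fM := GRing.isLinear.Build _ _ _ _ f lf.
by pose fL : {linear V -> Z} := HB.pack f fM; apply: (lfunE fL).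
Qed.

Lemma rank1E u v w : rank1 u v w = (v w : F) *: u.
Proof. by apply: linfunE => k w1 w2; rewrite linearP /= scalerDl scalerA. Qed.

Lemma endo_tr_sum x : endo_tr x = \sum_i coord (vbasis {:V}) i (x (vbasis {:V})`_i).
Proof.
rewrite /endo_tr /mxtrace; apply: eq_bigr => i _.
by rewrite /passmx.mxof !mxE /= passmx.vecof_delta.
Qed.

Lemma endo_tr_linear : linear (endo_tr : 'End(V) -> F^o).
Proof. by move=> k x y; rewrite /endo_tr passmx.mxof_linear mxtraceD mxtraceZ. Qed.

Lemma mem_sl x : (x \in sl) = (endo_tr x == 0).
Proof.
rewrite memv_ker; have lt := endo_tr_linear.
pose fM := GRing.isLinear.Build _ _ _ _ (endo_tr : 'End(V) -> F^o) lt.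
by pose fL : {linear 'End(V) -> F^o} := HB.pack (endo_tr : 'End(V) -> F^o) fM;
  rewrite (lfunE fL).
Qed.

Lemma endo_trD x y : endo_tr (x + y) = endo_tr x + endo_tr y.
Proof. by rewrite -[x]scale1r endo_tr_linear !scale1r. Qed.

Lemma endo_trZ k x : endo_tr (k *: x) = k * endo_tr x.
Proof.
have := endo_tr_linear k x 0; rewrite addr0 => ->.
by have := endo_tr_linear (-1) 0 0; rewrite scaler0 addr0 scaleN1r addNr => ->; rewrite addr0.
Qed.

Lemma endo_trB x y : endo_tr (x - y) = endo_tr x - endo_tr y.
Proof. by rewrite endo_trD -scaleN1r endo_trZ mulN1r. Qed.

Lemma endo_trC x y : endo_tr (x \o y)%VF = endo_tr (y \o x)%VF.
Proof. by rewrite /endo_tr !(passmx.mxof_comp _ _ (vbasisP _)) mxtrace_mulC. Qed.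

Lemma endo_tr1 : endo_tr \1%VF = (\dim {:V})%:R.
Proof. by rewrite /endo_tr passmx.mxof1 ?mxtrace1 // (basis_free (vbasisP _)). Qed.

Lemma endo_tr_rank1 u v : endo_tr (rank1 u v) = (v u : F).
Proof.
rewrite endo_tr_sum [u in RHS](coord_basis (vbasisP _) (memvf _)) linear_sum /=.
by apply: eq_bigr => i _; rewrite rank1E !linearZ /= [LHS]mulrC.
Qed.

End Endomorphisms.

(* vsproj (sl V) turns an element of 'End(V) lying in sl V into an element of
   the type subvs_of (sl V); see sl_brE, sl_circE and sl_rank1E. *)
Section SpecialLinear.
Variables (F : fieldType) (V : vectType F).
Local Notation slV := (subvs_of (sl V)).
Implicit Types (x y : slV).

Definition sl_br x y : slV :=
  vsproj (sl V) ((vsval x \o vsval y)%VF - (vsval y \o vsval x)%VF).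

Definition sl_circ x y : slV :=
  vsproj (sl V) ((vsval x \o vsval y)%VF + (vsval y \o vsval x)%VF
    - (2%:R / 3%:R * endo_tr (vsval x \o vsval y)%VF) *: \1%VF).

Definition sl_form x y : F := 3%:R^-1 * endo_tr (vsval x \o vsval y)%VF.

Definition sl_rank1 (u : V) (v : dual V) : slV :=
  vsproj (sl V) (rank1 u v - (3%:R^-1 * (v u : F)) *: \1%VF).

Definition sl_act x (u : V) : V := vsval x u.

Definition dual_act (v : dual V) x : dual V := (v \o vsval x)%VF.

Lemma sl_br_bilinear : is_bilinear sl_br.
Proof.
split=> z k x y; rewrite /sl_br -linearP; congr (vsproj _ _);
  by rewrite ?linearP /= ?comp_lfunDl ?comp_lfunDr -?comp_lfunZl -?comp_lfunZr
    opprD scalerBr addrACA.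
Qed.

Lemma sl_form_bilinear : is_bilinear (sl_form : slV -> slV -> F^o).
Proof.
by split=> z k x y; rewrite /sl_form ?linearP /= ?comp_lfunDl ?comp_lfunDr
  -?comp_lfunZl -?comp_lfunZr ?endo_trD ?endo_trZ mulrDr mulrCA.
Qed.

Lemma sl_circ_bilinear : is_bilinear sl_circ.
Proof.
by split=> z k x y; rewrite /sl_circ -linearP; congr (vsproj _ _);
  rewrite ?linearP /= ?comp_lfunDl ?comp_lfunDr -?comp_lfunZl -?comp_lfunZr
    endo_trD endo_trZ mulrDr scalerDl scalerBr scalerDr mulrCA scalerA
    opprD [X in X + _ = _]addrACA [LHS]addrACA.
Qed.

Lemma sl_rank1_bilinear : is_bilinear sl_rank1.
Proof.
split=> z k x y; rewrite /sl_rank1 -linearP; congr (vsproj _ _).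
- have -> : rank1 (k *: x + y) z = k *: rank1 x z + rank1 y z.
    apply/lfunP => w; do !rewrite ?lfunE ?rank1E /=.
    by rewrite scalerDr !scalerA mulrC.
  have -> : (z (k *: x + y) : F) = k * (z x : F) + (z y : F) by rewrite linearP.
  by rewrite mulrDr mulrCA scalerDl scalerBr scalerA opprD addrACA.
- have -> : rank1 z (k *: x + y) = k *: rank1 z x + rank1 z y.
    apply/lfunP => w; do !rewrite ?lfunE ?rank1E /=.
    by rewrite scalerDl scalerA.
  have -> : ((k *: x + y) z : F) = k * (x z : F) + (y z : F).
    by do !rewrite ?lfunE /=.
  by rewrite mulrDr mulrCA scalerDl scalerBr scalerA opprD addrACA.
Qed.

Lemma sl_act_bilinear : is_bilinear sl_act.
Proof. by split=> z k x y; rewrite /sl_act linearP // lfunE /= lfunE. Qed.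

Lemma dual_act_bilinear : is_bilinear dual_act.
Proof.
by split=> z k x y; rewrite /dual_act ?linearP /= ?comp_lfunDl ?comp_lfunDr
  -?comp_lfunZl -?comp_lfunZr.
Qed.

Lemma pairing_bilinear : is_bilinear (fun (u : V) (v : dual V) => v u).
Proof. by split=> z k x y; rewrite ?linearP // lfunE /= lfunE. Qed.

Lemma sl_br_anticomm x y : sl_br x y = - sl_br y x.
Proof. by rewrite /sl_br -linearN opprB. Qed.

Lemma sl_circ_comm x y : sl_circ x y = sl_circ y x.
Proof. by rewrite /sl_circ endo_trC; congr (vsproj _ (_ - _)); rewrite addrC. Qed.

Lemma sl_form_comm x y : sl_form x y = sl_form y x.
Proof. by rewrite /sl_form endo_trC. Qed.

Lemma sl_brE x y :
  vsval (sl_br x y) = (vsval x \o vsval y)%VF - (vsval y \o vsval x)%VF.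
Proof. by rewrite vsprojK // mem_sl endo_trB endo_trC subrr. Qed.

Hypotheses (char3 : 3%N \notin [pchar F]) (dimV : \dim {:V} = 3%N).

Let three_neq0 : (3%:R : F) != 0.
Proof. by apply: contra char3 => H; rewrite inE. Qed.

Lemma sl_circE x y : vsval (sl_circ x y) =
  (vsval x \o vsval y)%VF + (vsval y \o vsval x)%VF
    - (2%:R / 3%:R * endo_tr (vsval x \o vsval y)%VF) *: \1%VF.
Proof.
rewrite vsprojK // mem_sl endo_trB endo_trD endo_trZ endo_tr1 dimV.
rewrite [endo_tr (vsval y \o _)%VF]endo_trC mulrAC mulfVK // mulr_natl mulr2n.
by rewrite subrr.
Qed.

Lemma sl_rank1E u v :
  vsval (sl_rank1 u v) = rank1 u v - (3%:R^-1 * (v u : F)) *: \1%VF.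
Proof.
rewrite vsprojK // mem_sl endo_trB endo_trZ endo_tr1 dimV endo_tr_rank1.
by rewrite mulrAC mulVf // mul1r subrr.
Qed.

End SpecialLinear.

Section VolumeForm.
Variables (F : fieldType) (V : vectType F).

(* Linear maps from the third exterior power of V to F *)
Definition alternating3 (f : V -> V -> V -> F) : Prop :=
  [/\ forall y z, scalar (fun x => f x y z),
      forall x z, scalar (fun y => f x y z),
      forall x y, scalar (fun z => f x y z) &
      forall x y, [/\ f x x y = 0, f x y x = 0 & f y x x = 0]].

Definition pairing_det (f1 f2 f3 : dual V) (v1 v2 v3 : V) : F :=
  \det (\matrix_(i < 3, j < 3) ([:: f1; f2; f3]`_i [:: v1; v2; v3]`_j : F)).

Variable det : V -> V -> V -> F.
Local Notation e := (vbasis {:V}).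

(* Characterized by dual_detE *)
Definition dual_det (f1 f2 f3 : dual V) : F :=
  pairing_det f1 f2 f3 e`_0 e`_1 e`_2 / det e`_0 e`_1 e`_2.

Definition wedge (u1 u2 : V) : dual V := linfun (det u1 u2 : V -> F^o).

(* Characterized by dual_wedgeE *)
Definition dual_wedge (f1 f2 : dual V) : V :=
  \sum_(i < \dim {:V}) dual_det f1 f2 (linfun (coord e i : V -> F^o)) *: e`_i.

Hypotheses (det_alt : alternating3 det) (dimV : \dim {:V} = 3%N).

Lemma wedgeE u1 u2 u3 : wedge u1 u2 u3 = det u1 u2 u3.
Proof. by case: det_alt => _ _ l3 _; apply: (linfunE (f := det u1 u2 : V -> F^o)). Qed.

Lemma wedge_bilinear : is_bilinear wedge.
Proof.
case: (det_alt) => l1 l2 _ _.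
by split=> z k x y; apply/lfunP => w; do !rewrite ?lfunE ?wedgeE /=; rewrite ?l1 ?l2.
Qed.

Let coord3 v : exists a : 'I_3 -> F, v = \sum_(k < 3) a k *: e`_k.
Proof.
have := coord_basis (vbasisP {:V}) (memvf v).
move: (e); rewrite dimV => t ->.
by exists (fun k => coord t k v).
Qed.

Let detD1 x x' y z : det (x + x') y z = det x y z + det x' y z.
Proof. by case: det_alt => l _ _ _; have := l y z 1 x x'; rewrite scale1r mul1r. Qed.
Let detD2 x y y' z : det x (y + y') z = det x y z + det x y' z.
Proof. by case: det_alt => _ l _ _; have := l x z 1 y y'; rewrite scale1r mul1r. Qed.
Let detD3 x y z z' : det x y (z + z') = det x y z + det x y z'.
Proof. by case: det_alt => _ _ l _; have := l x y 1 z z'; rewrite scale1r mul1r. Qed.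
Let det_xx x y : [/\ det x x y = 0, det x y x = 0 & det y x x = 0].
Proof. by case: det_alt. Qed.
Let det_12 x y : det x x y = 0. Proof. by case: (det_xx x y). Qed.
Let det_13 x y : det x y x = 0. Proof. by case: (det_xx x y). Qed.
Let det_23 x y : det y x x = 0. Proof. by case: (det_xx x y). Qed.
Let det0 x y : [/\ det 0 x y = 0, det x 0 y = 0 & det x y 0 = 0].
Proof.
have z0 (k : F) : k = k + k -> k = 0.
  by move/esym/eqP; rewrite -subr_eq0 addrK => /eqP.
split; apply: z0.
- by rewrite -detD1 addr0.
- by rewrite -detD2 addr0.
- by rewrite -detD3 addr0.
Qed.
Let detZ1 k x y z : det (k *: x) y z = k * det x y z.
Proof.
case: det_alt => l _ _ _; have := l y z k x 0.
by have [-> _ _] := det0 y z; rewrite !addr0.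
Qed.
Let detZ2 k x y z : det x (k *: y) z = k * det x y z.
Proof.
case: det_alt => _ l _ _; have := l x z k y 0.
by have [_ -> _] := det0 x z; rewrite !addr0.
Qed.
Let detZ3 k x y z : det x y (k *: z) = k * det x y z.
Proof.
case: det_alt => _ _ l _; have := l x y k z 0.
by have [_ _ ->] := det0 x y; rewrite !addr0.
Qed.
Let det_swap12 x y z : det y x z = - det x y z.
Proof.
have [] := det_xx (x + y) z; rewrite !detD1 !detD2.
have [-> _ _] := det_xx x z; have [-> _ _] := det_xx y z.
by rewrite add0r addr0 addrC => /eqP; rewrite addr_eq0 => /eqP ->.
Qed.
Let det_swap23 x y z : det x z y = - det x y z.
Proof.
have [_ _] := det_xx (y + z) x; rewrite !detD2 !detD3.
have [_ _ ->] := det_xx y x; have [_ _ ->] := det_xx z x.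
by rewrite add0r addr0 addrC => /eqP; rewrite addr_eq0 => /eqP ->.
Qed.

Lemma wedge_anticomm u1 u2 : wedge u1 u2 = - wedge u2 u1.
Proof. by apply/lfunP => w; rewrite lfunE /= !wedgeE det_swap12. Qed.

Let det_expand (v : 'I_3 -> V) (a : 'M[F]_3) :
  (forall j, v j = \sum_(k < 3) a k j *: e`_k) ->
  det (v 0) (v 1) (v 2%:R) = \det a * det e`_0 e`_1 e`_2.
Proof.
move=> E; rewrite !E !big_ord_recl !big_ord0 /= !addr0.
rewrite !(detD1, detD2, detD3, detZ1, detZ2, detZ3) /=.
set x := e`_0; set y := e`_1; set z := e`_2.
rewrite !(det_12, det_13, det_23).
rewrite (det_swap12 y z x) (det_swap23 y x z) (det_swap12 x z y).
rewrite (det_swap12 x y z) (det_swap23 x y z).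
pose g i j := a (inord i) (inord j).
have Eg i j : a i j = g i j by rewrite /g !inord_val.
rewrite (expand_det_row a 0) !big_ord_recl big_ord0 /cofactor.
rewrite !(@expand_det_row _ 2 _ ord0) !big_ord_recl !big_ord0 /cofactor.
rewrite !det_mx11 !mxE !Eg /= /bump /=.
have m1 : (1 %% 3 = 1)%N by [].
rewrite !m1 !addn0 !add0n -![(1 + 1)%N]/2%N -![(2 %% 3)%N]/2%N !expr0 !expr1 sqrrN expr1n.
ring.
Qed.

Lemma dual_detE f1 f2 f3 v1 v2 v3 : (exists w1 w2 w3, det w1 w2 w3 != 0) ->
  dual_det f1 f2 f3 * det v1 v2 v3 = pairing_det f1 f2 f3 v1 v2 v3.
Proof.
have expand w1 w2 w3 : exists a : 'M[F]_3,
    (forall j : 'I_3, [:: w1; w2; w3]`_j = \sum_(k < 3) a k j *: e`_k) /\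
    det w1 w2 w3 = \det a * det e`_0 e`_1 e`_2.
  have [a1 E1] := coord3 w1; have [a2 E2] := coord3 w2; have [a3 E3] := coord3 w3.
  pose a := \matrix_(k < 3, j < 3) [:: a1 k; a2 k; a3 k]`_j.
  have E (j : 'I_3) : [:: w1; w2; w3]`_j = \sum_(k < 3) a k j *: e`_k.
    by case: j => [[|[|[|]]]] //= ? ; [rewrite E1|rewrite E2|rewrite E3];
      apply: eq_bigr => k _; rewrite mxE.
  by exists a; split => //; rewrite -(det_expand E).
case=> w1 [w2 [w3]]; have [aw [_ ->]] := expand w1 w2 w3.
rewrite mulf_eq0 negb_or => /andP[_ e0].
have [a [E ->]] := expand v1 v2 v3.
rewrite /dual_det mulrCA mulrC mulfVK // -det_mulmx; congr (\det _).
apply/matrixP => i j; rewrite !mxE E linear_sum; apply: eq_bigr => k _.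
rewrite !mxE linearZ [RHS]mulrC; congr (_ * _).
by case: k => [[|[|[|]]]].
Qed.

End VolumeForm.

Section DualWedge.
Variables (F : fieldType) (V : vectType F) (det : V -> V -> V -> F).
Local Notation e := (vbasis {:V}).
Implicit Types f : dual V.

Lemma pairing_det_linear v1 v2 v3 :
  [/\ forall f2 f3, scalar (fun f1 : dual V => pairing_det f1 f2 f3 v1 v2 v3),
      forall f1 f3, scalar (fun f2 : dual V => pairing_det f1 f2 f3 v1 v2 v3) &
      forall f1 f2, scalar (fun f3 : dual V => pairing_det f1 f2 f3 v1 v2 v3)].
Proof.
split=> f g k h h'; rewrite -[X in _ = _ + X]mul1r;
  [apply: (determinant_multilinear (i0 := 0))
  |apply: (determinant_multilinear (i0 := 1))
  |apply: (determinant_multilinear (i0 := 2%:R))];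
  try (by apply/rowP => j; rewrite !mxE /= lfunE /= lfunE /= mul1r);
  by apply/matrixP => -[[|[|[|]]] //= ?] j; rewrite !mxE.
Qed.

Lemma dual_det_linear :
  [/\ forall f2 f3, scalar (fun f1 : dual V => dual_det det f1 f2 f3),
      forall f1 f3, scalar (fun f2 : dual V => dual_det det f1 f2 f3) &
      forall f1 f2, scalar (fun f3 : dual V => dual_det det f1 f2 f3)].
Proof.
have [l1 l2 l3] := pairing_det_linear e`_0 e`_1 e`_2.
split=> f g k h h'; rewrite /dual_det;
  [rewrite l1|rewrite l2|rewrite l3]; by rewrite mulrDl mulrA.
Qed.

Lemma dual_wedge_bilinear : is_bilinear (dual_wedge det).
Proof.
have [l1 l2 _] := dual_det_linear.
split=> f k h h'; rewrite /dual_wedge scaler_sumr -big_split; apply: eq_bigr => i _ /=.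
  by rewrite l1 scalerDl scalerA.
by rewrite l2 scalerDl scalerA.
Qed.

Lemma dual_wedge_anticomm f1 f2 : dual_wedge det f1 f2 = - dual_wedge det f2 f1.
Proof.
rewrite /dual_wedge -sumrN; apply: eq_bigr => i _; rewrite -scaleNr; congr (_ *: _).
rewrite /dual_det -mulNr; congr (_ / _); apply/eqP; rewrite -addr_eq0; apply/eqP.
have diag g k : pairing_det g g k e`_0 e`_1 e`_2 = 0.
  by apply: (determinant_alternate (i1 := 0) (i2 := 1)) => // j; rewrite !mxE.
have [l1 l2 _] := pairing_det_linear e`_0 e`_1 e`_2.
set k := linfun _; have := diag (1 *: f1 + f2) k.
by rewrite l1 !l2 !diag !mul1r add0r addr0.
Qed.

Lemma dual_wedgeE f1 f2 f : (f (dual_wedge det f1 f2) : F) = dual_det det f1 f2 f.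
Proof.
have [_ _ l3] := dual_det_linear.
have d0 : dual_det det f1 f2 0 = 0.
  by have := l3 f1 f2 (-1) 0 0; rewrite scaler0 addr0 mulN1r addNr.
have {2}-> : f = \sum_(i < \dim {:V}) (f e`_i : F) *: linfun (coord e i : V -> F^o).
  apply/lfunP => v; rewrite {1}(coord_basis (vbasisP {:V}) (memvf v)) linear_sum.
  rewrite sum_lfunE; apply: eq_bigr => i _; rewrite linearZ lfunE /= lfunE /=.
  by rewrite [LHS]mulrC.
rewrite /dual_wedge linear_sum /=.
have -> : forall l : seq 'I_(\dim {:V}), dual_det det f1 f2
    (\sum_(i <- l) (f e`_i : F) *: linfun (coord e i : V -> F^o)) =
    \sum_(i <- l) (f e`_i : F) * dual_det det f1 f2 (linfun (coord e i : V -> F^o)).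
  by elim=> [|i l IH]; rewrite ?big_nil // !big_cons l3 IH.
by apply: eq_bigr => i _; rewrite linearZ /= [LHS]mulrC.
Qed.

End DualWedge.

Section Multilinearity.
Variable (F : fieldType).

Definition is_quadrilinear (U W U' W' Z : lmodType F)
    (f : U -> W -> U' -> W' -> Z) : Prop :=
  (forall u w, is_bilinear (f u w)) /\
  (forall u' w', is_bilinear (fun u w => f u w u' w')).

Lemma tensor_lift2_bilinear (U W U' W' Z : lmodType F) (f : U -> W -> U' -> W' -> Z) :
  is_quadrilinear f -> is_bilinear (tensor_lift2 f).
Proof.
case=> qf1 qf2.
have b (t' : tensor U' W') : is_bilinear (fun u w => tensor_lift (f u w) t').
  split=> [w k u1 u2|u k w1 w2]; rewrite /tensor_lift /formal_eval scaler_sumr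
    -big_split; apply: eq_bigr => p _; [exact: (qf2 _ _).1|exact: (qf2 _ _).2].
split=> [t'|t] k x y; first exact: (tensor_lift_linear (b t')).
rewrite /tensor_lift2 {1 3 5}/tensor_lift /formal_eval scaler_sumr -big_split.
by apply: eq_bigr => p _; apply: tensor_lift_linear.
Qed.

Lemma tensor_lift2_pure (U W U' W' Z : lmodType F) (f : U -> W -> U' -> W' -> Z) u w u' w' :
  is_quadrilinear f -> tensor_lift2 f (pure u w) (pure u' w') = f u w u' w'.
Proof.
move=> qf; case: (qf) => qf1 qf2.
rewrite /tensor_lift2 tensor_lift_pure ?tensor_lift_pure //.
split=> [y k u1 u2|x k w1 w2]; rewrite /tensor_lift /formal_eval scaler_sumr
  -big_split; apply: eq_bigr => p _; [exact: (qf2 _ _).1|exact: (qf2 _ _).2].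
Qed.

Lemma tensor_lift2_anticomm (U W Z : lmodType F) (f : U -> W -> U -> W -> Z) t t' :
  (forall u w u' w', f u w u' w' = - f u' w' u w) ->
  tensor_lift2 f t t' = - tensor_lift2 f t' t.
Proof.
move=> anti; rewrite /tensor_lift2 /tensor_lift /formal_eval exchange_big /= -sumrN.
by apply: eq_bigr => p _; rewrite -sumrN; apply: eq_bigr => q _.
Qed.

Lemma bilinearP (U W Z : lmodType F) (f : {bilinear U -> W -> Z}) : is_bilinear f.
Proof. by split=> [w k x y|u k x y]; [rewrite linearPl|rewrite linearPr]. Qed.

Lemma scale_bilinear (U W Z : lmodType F) k (f : U -> W -> Z) :
  is_bilinear f -> is_bilinear (fun u w => k *: f u w).
Proof.
by case=> f1 f2; split=> [w|u] l x y; rewrite ?f1 ?f2 scalerDr !scalerA mulrC.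
Qed.

Lemma comp_bilinear (U W Z Z' : lmodType F) (g : Z -> Z') (f : U -> W -> Z) :
  linear g -> is_bilinear f -> is_bilinear (fun u w => g (f u w)).
Proof. by move=> lg [f1 f2]; split=> [w|u] l x y; rewrite ?f1 ?f2 lg. Qed.

Lemma add_bilinear (U W Z : lmodType F) (f g : U -> W -> Z) :
  is_bilinear f -> is_bilinear g -> is_bilinear (fun u w => f u w + g u w).
Proof.
move=> [f1 f2] [g1 g2].
by split=> z k x y; rewrite ?f1 ?f2 ?g1 ?g2 scalerDr addrACA.
Qed.

Lemma precomp_bilinear (L U W Z : lmodType F) (f : U -> W -> Z) (g : L -> U) (h : L -> W) :
  is_bilinear f -> linear g -> linear h -> is_bilinear (fun p q => f (g p) (h q)).
Proof. by move=> [f1 f2] lg lh; split=> z k x y; rewrite ?lg ?lh ?f1 ?f2. Qed.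

Lemma skew_bilinear (L U W Z : lmodType F) (f : U -> W -> Z) (g : L -> U) (h : L -> W) :
  is_bilinear f -> linear g -> linear h ->
  is_bilinear (fun p q => f (g p) (h q) - f (g q) (h p)).
Proof.
by move=> [f1 f2] lg lh; split=> z k x y; rewrite lg lh f1 f2 scalerBr opprD addrACA.
Qed.

Lemma pure_quadrilinear (U W U' W' P Q : lmodType F) (p : U -> U' -> P) (q : W -> W' -> Q) :
  is_bilinear p -> is_bilinear q ->
  is_quadrilinear (fun u w u' w' => pure (p u u') (q w w')).
Proof.
have [b1 b2] := pure_bilinear P Q.
by move=> [p1 p2] [q1 q2]; split=> x x'; split=> y k z z';
  rewrite ?p1 ?p2 ?q1 ?q2 ?b1 ?b2.
Qed.

Lemma scale_quadrilinear (U W U' W' Q : lmodType F) (p : U -> U' -> F^o) (q : W -> W' -> Q) :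
  is_bilinear p -> is_bilinear q ->
  is_quadrilinear (fun u w u' w' => (p u u' : F) *: q w w').
Proof.
move=> [p1 p2] [q1 q2]; split=> x x'; split=> y k z z';
  rewrite ?p1 ?p2 ?q1 ?q2 ?scalerDl ?scalerDr ?scalerA //.
all: by rewrite [in RHS]mulrC.
Qed.

Lemma comp_quadrilinear (U W U' W' Z Z' : lmodType F) (g : Z -> Z')
    (f : U -> W -> U' -> W' -> Z) :
  linear g -> is_quadrilinear f -> is_quadrilinear (fun u w u' w' => g (f u w u' w')).
Proof.
by move=> lg [f1 f2]; split=> x y; [exact: (comp_bilinear lg (f1 x y))
  |exact: (comp_bilinear lg (f2 x y))].
Qed.

Lemma add_quadrilinear (U W U' W' Z : lmodType F) (f g : U -> W -> U' -> W' -> Z) :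
  is_quadrilinear f -> is_quadrilinear g ->
  is_quadrilinear (fun u w u' w' => f u w u' w' + g u w u' w').
Proof.
move=> [f1 f2] [g1 g2]; split=> x y; split=> z k t t'.
- by rewrite (f1 x y).1 (g1 x y).1 scalerDr addrACA.
- by rewrite (f1 x y).2 (g1 x y).2 scalerDr addrACA.
- by rewrite (f2 x y).1 (g2 x y).1 scalerDr addrACA.
- by rewrite (f2 x y).2 (g2 x y).2 scalerDr addrACA.
Qed.

End Multilinearity.

Section Properties.
Variable (F : fieldType).

Definition is_lie_bracket (L : lmodType F) (br : L -> L -> L) : Prop :=
  [/\ is_bilinear br,
      forall x, br x x = 0 &
      forall x y z, br x (br y z) + br y (br z x) + br z (br x y) = 0].

Definition is_lie_module (s M : lmodType F) (br : s -> s -> s) (act : s -> M -> M) : Prop :=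
  is_bilinear act /\ forall d d' m, act (br d d') m = act d (act d' m) - act d' (act d m).

Definition s_invariant (s M N P : lmodType F) (actM : s -> M -> M) (actN : s -> N -> N)
    (actP : s -> P -> P) (f : M -> N -> P) : Prop :=
  forall d p q, actP d (f p q) = f (actM d p) q + f p (actN d q).

Definition is_alternative (A : lmodType F) (mul : A -> A -> A) : Prop :=
  forall x y, mul (mul x x) y = mul x (mul x y) /\ mul (mul y x) x = mul y (mul x x).

End Properties.

Definition symmetric3 (M N : Type) (f : M -> M -> M -> N) : Prop :=
  forall x y z, [/\ f y x z = f x y z, f x z y = f x y z, f z y x = f x y z,
                    f y z x = f x y z & f z x y = f x y z].

Record coord_data (F : fieldType) (A B C s : lmodType F) := CoordData {
  circ   : {bilinear A -> A -> A};
  comm   : {bilinear A -> A -> A};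
  DA     : {bilinear A -> A -> s};
  lmulB  : {bilinear A -> B -> B};  (* (a, b) |-> ab *)
  rmulC  : {bilinear C -> A -> C};  (* (c, a) |-> ca *)
  TBC    : {bilinear B -> C -> A};
  DBC    : {bilinear B -> C -> s};
  crossB : {bilinear B -> B -> C};
  crossC : {bilinear C -> C -> B};
  sA     : {bilinear s -> A -> A};
  sB     : {bilinear s -> B -> B};
  sC     : {bilinear s -> C -> C};
  sbr    : {bilinear s -> s -> s};
  oneA   : A;
  circ_comm       : forall a a', circ a a' = circ a' a;
  comm_anticomm   : forall a a', comm a a' = - comm a' a;
  DA_skew         : forall a a', DA a a' = - DA a' a;
  crossB_sym      : forall b b', crossB b b' = crossB b' b;
  crossC_sym      : forall c c', crossC c c' = crossC c' c;
  sbr_anticomm    : forall d d', sbr d d' = - sbr d' d;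
  circ_oneA       : forall a, circ oneA a = 2%:R *: a;
  comm_oneA       : forall a, comm oneA a = 0;
  DA_oneA         : forall a, DA oneA a = 0;
  lmulB_oneA      : forall b, lmulB oneA b = b;
  rmulC_oneA      : forall c, rmulC c oneA = c;
  sA_oneA         : forall d, sA d oneA = 0
}.

Definition altmul (F : fieldType) (A B C s : lmodType F) (X : coord_data A B C s) (a a' : A) : A :=
  2%:R^-1 *: circ X a a' + 2%:R^-1 *: comm X a a'.

Section GradedAlgebra.
Variables (F : fieldType) (V : vectType F) (A B C s : lmodType F).

Definition graded : Type :=
  (tensor (subvs_of (sl V)) A * tensor V B * tensor (dual V) C * s)%type.
HB.instance Definition _ := GRing.Lmodule.on graded.

Definition inA (t : tensor (subvs_of (sl V)) A) : graded := (t, 0, 0, 0).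
Definition inB (t : tensor V B) : graded := (0, t, 0, 0).
Definition inC (t : tensor (dual V) C) : graded := (0, 0, t, 0).
Definition inS (d : s) : graded := (0, 0, 0, d).

Variables (det : V -> V -> V -> F) (X : coord_data A B C s).

Definition br_AA := tensor_lift2 (fun x a y a' =>
  inA (pure (sl_br x y) (2%:R^-1 *: circ X a a'))
  + inA (pure (sl_circ x y) (2%:R^-1 *: comm X a a'))
  + inS (sl_form x y *: DA X a a')).
Definition br_AB := tensor_lift2 (fun (x : subvs_of (sl V)) a u b =>
  inB (pure (sl_act x u) (lmulB X a b))).
Definition br_CA := tensor_lift2 (fun (v : dual V) c x a =>
  inC (pure (dual_act v x) (rmulC X c a))).
Definition br_BC := tensor_lift2 (fun u b v c =>
  inA (pure (sl_rank1 u v) (TBC X b c)) + inS ((3%:R^-1 * (v u : F)) *: DBC X b c)).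
Definition br_BB := tensor_lift2 (fun u1 b1 u2 b2 =>
  inC (pure (wedge det u1 u2) (crossB X b1 b2))).
Definition br_CC := tensor_lift2 (fun v1 c1 v2 c2 =>
  inB (pure (dual_wedge det v1 v2) (crossC X c1 c2))).
Definition br_SA d := tensor_lift (fun (x : subvs_of (sl V)) a => inA (pure x (sA X d a))).
Definition br_SB d := tensor_lift (fun (u : V) b => inB (pure u (sB X d b))).
Definition br_SC d := tensor_lift (fun (v : dual V) c => inC (pure v (sC X d c))).

(* The bilinear anticommutative extension of the formulas above *)
Definition bracket (p q : graded) : graded :=
  let: (tA, tB, tC, d) := p in
  let: (tA', tB', tC', d') := q in
  br_AA tA tA' + br_BB tB tB' + br_CC tC tC' + inS (sbr X d d')
  + (br_AB tA tB' - br_AB tA' tB)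
  + (br_CA tC tA' - br_CA tC' tA)
  + (br_BC tB tC' - br_BC tB' tC)
  + (br_SA d tA' - br_SA d' tA)
  + (br_SB d tB' - br_SB d' tB)
  + (br_SC d tC' - br_SC d' tC).

Lemma inA_linear : linear inA.
Proof. by move=> k x y; rewrite /inA; do !congr (_, _); rewrite /= ?scaler0 ?addr0. Qed.
Lemma inB_linear : linear inB.
Proof. by move=> k x y; rewrite /inB; do !congr (_, _); rewrite /= ?scaler0 ?addr0. Qed.
Lemma inC_linear : linear inC.
Proof. by move=> k x y; rewrite /inC; do !congr (_, _); rewrite /= ?scaler0 ?addr0. Qed.
Lemma inS_linear : linear inS.
Proof. by move=> k x y; rewrite /inS; do !congr (_, _); rewrite /= ?scaler0 ?addr0. Qed.

Let AA_quad : is_quadrilinear (fun x a y a' =>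
  inA (pure (sl_br x y) (2%:R^-1 *: circ X a a'))
  + inA (pure (sl_circ x y) (2%:R^-1 *: comm X a a'))
  + inS (sl_form x y *: DA X a a')).
Proof.
apply: add_quadrilinear; first apply: add_quadrilinear.
- apply: (comp_quadrilinear inA_linear); apply: pure_quadrilinear.
    exact: sl_br_bilinear.
  exact/scale_bilinear/bilinearP.
- apply: (comp_quadrilinear inA_linear); apply: pure_quadrilinear.
    exact: sl_circ_bilinear.
  exact/scale_bilinear/bilinearP.
- apply: (comp_quadrilinear inS_linear); apply: scale_quadrilinear.
    exact: sl_form_bilinear.
  exact: bilinearP.
Qed.

Let AB_quad : is_quadrilinear (fun (x : subvs_of (sl V)) a u b =>
  inB (pure (sl_act x u) (lmulB X a b))).
Proof.
apply: (comp_quadrilinear inB_linear); apply: pure_quadrilinear.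
  exact: sl_act_bilinear.
exact: bilinearP.
Qed.

Let CA_quad : is_quadrilinear (fun (v : dual V) c x a =>
  inC (pure (dual_act v x) (rmulC X c a))).
Proof.
apply: (comp_quadrilinear inC_linear); apply: pure_quadrilinear.
  exact: dual_act_bilinear.
exact: bilinearP.
Qed.

Let BC_quad : is_quadrilinear (fun (u : V) b (v : dual V) c =>
  inA (pure (sl_rank1 u v) (TBC X b c)) + inS ((3%:R^-1 * (v u : F)) *: DBC X b c)).
Proof.
apply: add_quadrilinear.
  apply: (comp_quadrilinear inA_linear); apply: pure_quadrilinear.
    exact: sl_rank1_bilinear.
  exact: bilinearP.
apply: (comp_quadrilinear inS_linear); apply: scale_quadrilinear.
  exact: (scale_bilinear _ (@pairing_bilinear F V)).
exact: bilinearP.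
Qed.

Let CC_quad : is_quadrilinear (fun v1 c1 v2 c2 =>
  inB (pure (dual_wedge det v1 v2) (crossC X c1 c2))).
Proof.
apply: (comp_quadrilinear inB_linear); apply: pure_quadrilinear.
  exact: dual_wedge_bilinear.
exact: bilinearP.
Qed.

Let SA_bil d : is_bilinear (fun (x : subvs_of (sl V)) a => inA (pure x (sA X d a))).
Proof.
apply: (comp_bilinear inA_linear); have [b1 b2] := pure_bilinear (subvs_of (sl V)) A.
by split=> y k z z'; rewrite ?linearPr ?b1 ?b2.
Qed.
Let SB_bil d : is_bilinear (fun (u : V) b => inB (pure u (sB X d b))).
Proof.
apply: (comp_bilinear inB_linear); have [b1 b2] := pure_bilinear V B.
by split=> y k z z'; rewrite ?linearPr ?b1 ?b2.
Qed.
Let SC_bil d : is_bilinear (fun (v : dual V) c => inC (pure v (sC X d c))).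
Proof.
apply: (comp_bilinear inC_linear); have [b1 b2] := pure_bilinear (dual V) C.
by split=> y k z z'; rewrite ?linearPr ?b1 ?b2.
Qed.

Let br_SA_bil : is_bilinear br_SA.
Proof.
split=> [t|d]; last exact: tensor_lift_linear (SA_bil d).
move=> k x y; have [b1 b2] := pure_bilinear (subvs_of (sl V)) A.
rewrite /br_SA /tensor_lift /formal_eval scaler_sumr -big_split.
by apply: eq_bigr => p _; rewrite linearPl b2 inA_linear.
Qed.
Let br_SB_bil : is_bilinear br_SB.
Proof.
split=> [t|d]; last exact: tensor_lift_linear (SB_bil d).
move=> k x y; have [b1 b2] := pure_bilinear V B.
rewrite /br_SB /tensor_lift /formal_eval scaler_sumr -big_split.
by apply: eq_bigr => p _; rewrite linearPl b2 inB_linear.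
Qed.
Let br_SC_bil : is_bilinear br_SC.
Proof.
split=> [t|d]; last exact: tensor_lift_linear (SC_bil d).
move=> k x y; have [b1 b2] := pure_bilinear (dual V) C.
rewrite /br_SC /tensor_lift /formal_eval scaler_sumr -big_split.
by apply: eq_bigr => p _; rewrite linearPl b2 inC_linear.
Qed.

Hypotheses (det_alt : alternating3 det).

Let BB_quad : is_quadrilinear (fun u1 b1 u2 b2 =>
  inC (pure (wedge det u1 u2) (crossB X b1 b2))).
Proof.
apply: (comp_quadrilinear inC_linear); apply: pure_quadrilinear.
  exact: wedge_bilinear.
exact: bilinearP.
Qed.

Let bil0 (P Q R : lmodType F) (f : P -> Q -> R) :
  is_bilinear f -> (forall q, f 0 q = 0) * (forall p, f p 0 = 0).
Proof.
case=> f1 f2; split=> z.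
  by have := f1 z (-1) 0 0; rewrite scaler0 addr0 scaleN1r addNr.
by have := f2 z (-1) 0 0; rewrite scaler0 addr0 scaleN1r addNr.
Qed.

Let AA_bil : is_bilinear br_AA. Proof. exact: tensor_lift2_bilinear. Qed.
Let AB_bil : is_bilinear br_AB. Proof. exact: tensor_lift2_bilinear. Qed.
Let CA_bil : is_bilinear br_CA. Proof. exact: tensor_lift2_bilinear. Qed.
Let BC_bil : is_bilinear br_BC. Proof. exact: tensor_lift2_bilinear. Qed.
Let BB_bil : is_bilinear br_BB. Proof. exact: tensor_lift2_bilinear. Qed.
Let CC_bil : is_bilinear br_CC. Proof. exact: tensor_lift2_bilinear. Qed.

Let br0 := (bil0 AA_bil, bil0 AB_bil, bil0 CA_bil, bil0 BC_bil, bil0 BB_bil,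
  bil0 CC_bil, bil0 br_SA_bil, bil0 br_SB_bil, bil0 br_SC_bil,
  bil0 (bilinearP (sbr X))).

Let inS0 : inS 0 = 0. Proof. by []. Qed.

Let bracketE := (br0, inS0, oppr0, addr0, add0r).

Lemma bracket_AA x a y a' : bracket (inA (pure x a)) (inA (pure y a')) =
  inA (pure (sl_br x y) (2%:R^-1 *: circ X a a'))
  + inA (pure (sl_circ x y) (2%:R^-1 *: comm X a a'))
  + inS (sl_form x y *: DA X a a').
Proof. by rewrite /bracket /= !bracketE; apply: (tensor_lift2_pure _ _ _ _ AA_quad). Qed.

Lemma bracket_AB x a u b : bracket (inA (pure x a)) (inB (pure u b)) =
  inB (pure (sl_act x u) (lmulB X a b)).
Proof. by rewrite /bracket /= !bracketE; apply: (tensor_lift2_pure _ _ _ _ AB_quad). Qed.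

Lemma bracket_CA v c x a : bracket (inC (pure v c)) (inA (pure x a)) =
  inC (pure (dual_act v x) (rmulC X c a)).
Proof. by rewrite /bracket /= !bracketE; apply: (tensor_lift2_pure _ _ _ _ CA_quad). Qed.

Lemma bracket_BC u b v c : bracket (inB (pure u b)) (inC (pure v c)) =
  inA (pure (sl_rank1 u v) (TBC X b c)) + inS ((3%:R^-1 * (v u : F)) *: DBC X b c).
Proof. by rewrite /bracket /= !bracketE; apply: (tensor_lift2_pure _ _ _ _ BC_quad). Qed.

Lemma bracket_BB u1 b1 u2 b2 : bracket (inB (pure u1 b1)) (inB (pure u2 b2)) =
  inC (pure (wedge det u1 u2) (crossB X b1 b2)).
Proof. by rewrite /bracket /= !bracketE; apply: (tensor_lift2_pure _ _ _ _ BB_quad). Qed.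

Lemma bracket_CC v1 c1 v2 c2 : bracket (inC (pure v1 c1)) (inC (pure v2 c2)) =
  inB (pure (dual_wedge det v1 v2) (crossC X c1 c2)).
Proof. by rewrite /bracket /= !bracketE; apply: (tensor_lift2_pure _ _ _ _ CC_quad). Qed.

Lemma bracket_SA d x a : bracket (inS d) (inA (pure x a)) = inA (pure x (sA X d a)).
Proof. by rewrite /bracket /= !bracketE; apply: tensor_lift_pure (SA_bil d). Qed.

Lemma bracket_SB d u b : bracket (inS d) (inB (pure u b)) = inB (pure u (sB X d b)).
Proof. by rewrite /bracket /= !bracketE; apply: tensor_lift_pure (SB_bil d). Qed.

Lemma bracket_SC d v c : bracket (inS d) (inC (pure v c)) = inC (pure v (sC X d c)).
Proof. by rewrite /bracket /= !bracketE; apply: tensor_lift_pure (SC_bil d). Qed.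

Lemma bracket_SS d d' : bracket (inS d) (inS d') = inS (sbr X d d').
Proof. by rewrite /bracket /= !bracketE. Qed.

Lemma bracket_bilinear : is_bilinear bracket.
Proof.
have pA : linear (fun p : graded => p.1.1.1) by [].
have pB : linear (fun p : graded => p.1.1.2) by [].
have pC : linear (fun p : graded => p.1.2) by [].
have pS : linear (fun p : graded => p.2) by [].
have SS_bil : is_bilinear (fun d d' => inS (sbr X d d')).
  exact/(comp_bilinear inS_linear)/bilinearP.
have -> : bracket = fun p q =>
    br_AA p.1.1.1 q.1.1.1 + br_BB p.1.1.2 q.1.1.2 + br_CC p.1.2 q.1.2
    + inS (sbr X p.2 q.2)
    + (br_AB p.1.1.1 q.1.1.2 - br_AB q.1.1.1 p.1.1.2)
    + (br_CA p.1.2 q.1.1.1 - br_CA q.1.2 p.1.1.1)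
    + (br_BC p.1.1.2 q.1.2 - br_BC q.1.1.2 p.1.2)
    + (br_SA p.2 q.1.1.1 - br_SA q.2 p.1.1.1)
    + (br_SB p.2 q.1.1.2 - br_SB q.2 p.1.1.2)
    + (br_SC p.2 q.1.2 - br_SC q.2 p.1.2).
  by apply/funext => -[[[? ?] ?] ?]; apply/funext => -[[[? ?] ?] ?].
apply: add_bilinear; last exact: (skew_bilinear br_SC_bil pS pC).
apply: add_bilinear; last exact: (skew_bilinear br_SB_bil pS pB).
apply: add_bilinear; last exact: (skew_bilinear br_SA_bil pS pA).
apply: add_bilinear; last exact: (skew_bilinear BC_bil pB pC).
apply: add_bilinear; last exact: (skew_bilinear CA_bil pC pA).
apply: add_bilinear; last exact: (skew_bilinear AB_bil pA pB).
apply: add_bilinear; last exact: (precomp_bilinear SS_bil pS pS).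
apply: add_bilinear; last exact: (precomp_bilinear CC_bil pC pC).
apply: add_bilinear; last exact: (precomp_bilinear BB_bil pB pB).
exact: (precomp_bilinear AA_bil pA pA).
Qed.

Lemma bracket_anticomm p q : bracket p q = - bracket q p.
Proof.
have inSN x : inS (- x) = - inS x.
  have := inS_linear (-1) x 0; rewrite addr0 !scaleN1r => ->.
  by have -> : inS 0 = 0 by []; rewrite addr0.
have pureNl (U W : lmodType F) (u : U) (w : W) : pure (- u) w = - pure u w.
  have [b _] := pure_bilinear U W; have := b w (-1) u 0.
  by rewrite (bil0 (pure_bilinear U W)).1 !addr0 !scaleN1r.
have pureNr (U W : lmodType F) (u : U) (w : W) : pure u (- w) = - pure u w.
  have [_ b] := pure_bilinear U W; have := b u (-1) w 0.
  by rewrite (bil0 (pure_bilinear U W)).2 !addr0 !scaleN1r.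
have inAN x : inA (- x) = - inA x.
  have := inA_linear (-1) x 0; rewrite addr0 !scaleN1r => ->.
  by have -> : inA 0 = 0 by []; rewrite addr0.
have inBN x : inB (- x) = - inB x.
  have := inB_linear (-1) x 0; rewrite addr0 !scaleN1r => ->.
  by have -> : inB 0 = 0 by []; rewrite addr0.
have inCN x : inC (- x) = - inC x.
  have := inC_linear (-1) x 0; rewrite addr0 !scaleN1r => ->.
  by have -> : inC 0 = 0 by []; rewrite addr0.
have AAN t t' : br_AA t t' = - br_AA t' t.
  apply: tensor_lift2_anticomm => x a y a'.
  rewrite (sl_br_anticomm x y) (sl_circ_comm x y) (sl_form_comm x y).
  rewrite (circ_comm X a a') (comm_anticomm X a a') (DA_skew X a a').
  by rewrite !scalerN pureNl pureNr inAN inAN inSN !opprD.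
have BBN t t' : br_BB t t' = - br_BB t' t.
  apply: tensor_lift2_anticomm => u b u' b'.
  by rewrite (wedge_anticomm det_alt u u') (crossB_sym X b b') pureNl inCN.
have CCN t t' : br_CC t t' = - br_CC t' t.
  apply: tensor_lift2_anticomm => u b u' b'.
  by rewrite (dual_wedge_anticomm det u u') (crossC_sym X b b') pureNl inBN.
case: p q => [[[tA tB] tC] d] [[[tA' tB'] tC'] d']; rewrite /bracket.
rewrite (AAN tA) (BBN tB) (CCN tC) (sbr_anticomm X d) inSN.
have key (G : zmodType) (a b c e f f' g g' h h' i i' j j' k k' : G) :
    - a - b - c - e + (f - f') + (g - g') + (h - h') + (i - i') + (j - j') + (k - k')
    = - (a + b + c + e + (f' - f) + (g' - g) + (h' - h) + (i' - i) + (j' - j) + (k' - k)).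
  by rewrite -(opprB f' f) -(opprB g' g) -(opprB h' h) -(opprB i' i)
    -(opprB j' j) -(opprB k' k) -!opprD.
exact: key.
Qed.

End GradedAlgebra.

(* Main.v *)
Require Import Defs.
From HB Require Import structures.
From mathcomp Require Import all_boot all_algebra.
From mathcomp Require Import ring.
Import GRing.Theory.
Local Open Scope ring_scope.

(** The bracket is bilinear and anticommutative by construction, and [2] is invertible, so it is
    a Lie bracket exactly when its Jacobiator vanishes. The Jacobiator is an alternating trilinear
    map, so it is enough to look at homogeneous elements [x ⊗ a], [u ⊗ b], [v ⊗ c], [d], one triple
    for each multiset of three of the four types A, B, C, S: twenty families of equations
    ([lie_bracket_generators]).

    Each family reads [sum_k t_k ⊗ m_k = 0], where the [t_k] are built from the endomorphisms,
    vectors and covectors and the [m_k] from the coordinate spaces. The evaluations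
    [x |-> f (x v)], [u |-> f u], [v |-> v u] separate the points of the tensor products
    ([graded_separated]), so that each family becomes a scalar identity [sum_k s_k *: m_k = 0] in a
    coordinate space. These identities are the lemmas [jacobiator_XYZ], one for each triple of
    types; the most telling one is [jacobiator_AAA], which results from writing the bracket of
    [x ⊗ a] and [y ⊗ b] as [xy ⊗ ab - yx ⊗ ba - (x|y) 1 ⊗ (ab - ba) + (x|y) D_(a,b)] in
    End(V) ⊗ A + s.

    The lemmas [jacobi_XYZ] then turn each family into conditions on the coordinate spaces.
    - From the Jacobi identity to the conditions: the endomorphisms [e_i eps_j], made traceless,
      and the members of a pair of dual bases [e], [eps] are substituted for [x], [u], [v] in such
      a way that few of the scalars [s_k] survive.
    - From the conditions to the Jacobi identity: the conditions make the [m_k] vanish or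
      identify them with each other, and then the sum of the [s_k] vanishes by an identity of the three-dimensional space V:
      the volume change [det (xu1) u2 u3 + ... = tr x * det u1 u2 u3] for ABB and ACC
      ([det_trace], [dual_det_trace]), Cramer's rule for BBB and CCC ([det_cramer],
      [dual_det_cramer]), and the polarized Cayley-Hamilton identity for AAA
      ([cayley_hamilton3]). For BBC and BCC the contraction of a covector with [u1 ∧ u2], and of a
      vector with [v1 ∧ v2], brings the double products to the same shape as the other terms
      ([dual_wedge_wedge], [wedge_dual_wedge]).

    The ten triples with a member in s say that s is a Lie algebra, A, B, C are modules and all
    the maps are invariant. AAA gives alternativity and the two formulas for D on A; AAB and AAC
    make B and C associative modules; ABC compares T and D with the actions of A; ABB and ACC make
    the products [×] balanced; BBB and CCC give the symmetry of T and the cyclic relation for D;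
    BBC and BCC express [(b1 × b2) × c] and [b × (c1 × c2)]. *)

Set Implicit Arguments.
Unset Strict Implicit.
Unset Printing Implicit Defensive.

(** * Identities between linear combinations *)

Section LinearCombination.
Variables (F : fieldType) (M : lmodType F).

(** Linear combinations of a list of atoms of [M]. Two of them agree as soon as the coefficients
    of each atom do, which turns an equation in [M] into equations in [F] that [ring] and
    [field] can decide. *)
Inductive lincomb :=
  | LVar of nat | LZero | LAdd of lincomb & lincomb | LOpp of lincomb
  | LScale of F & lincomb.

Fixpoint lc_eval (env : seq M) (t : lincomb) : M :=
  match t with
  | LVar i => nth 0 env i
  | LZero => 0
  | LAdd t1 t2 => lc_eval env t1 + lc_eval env t2
  | LOpp t1 => - lc_eval env t1
  | LScale k t1 => k *: lc_eval env t1
  end.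

Fixpoint lc_coef (t : lincomb) (i : nat) : F :=
  match t with
  | LVar j => if eqn j i then 1 else 0
  | LZero => 0
  | LAdd t1 t2 => lc_coef t1 i + lc_coef t2 i
  | LOpp t1 => - lc_coef t1 i
  | LScale k t1 => k * lc_coef t1 i
  end.

Fixpoint lc_same (t1 t2 : lincomb) (n : nat) : Prop :=
  if n is n'.+1 then lc_coef t1 n' = lc_coef t2 n' /\ lc_same t1 t2 n' else True.

Lemma lc_evalE env t :
  lc_eval env t = \sum_(i < size env) lc_coef t i *: nth 0 env i.
Proof.
elim: t => /= [j||t1 -> t2 ->|t1 ->|k t1 ->].
- have [lt_j|ge_j] := ltnP j (size env).
    rewrite (bigD1 (Ordinal lt_j)) //= -[eqn j j]/(j == j) eqxx scale1r big1 ?addr0 //.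
    move=> i ne_ij; rewrite -[eqn j i]/(j == i) ifN ?scale0r //.
    by apply: contra ne_ij => /eqP E; apply/eqP/val_inj; rewrite /= E.
  rewrite nth_default // big1 // => i _; rewrite -[eqn j i]/(j == i) ifN ?scale0r //.
  by apply: contraL (ltn_ord i) => /eqP <-; rewrite -leqNgt.
- by rewrite big1 // => i _; rewrite scale0r.
- by rewrite -big_split; apply: eq_bigr => i _; rewrite scalerDl.
- by rewrite -sumrN; apply: eq_bigr => i _; rewrite scaleNr.
- by rewrite scaler_sumr; apply: eq_bigr => i _; rewrite scalerA.
Qed.

Lemma lc_sameP env t1 t2 :
  lc_same t1 t2 (size env) -> lc_eval env t1 = lc_eval env t2.
Proof.
rewrite !lc_evalE; move: (size env) => n same; apply: eq_bigr => -[i lt_in] _ /=.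
congr (_ *: _); elim: n lt_in same => //= n IHn; rewrite ltnS leq_eqVlt.
by case/predU1P=> [-> []|lt_in [_ /IHn]] //; apply.
Qed.

(** The usual way to extract a condition from a vanishing combination [m]: the difference of
    the two sides of the condition is a multiple of [m]. *)
Lemma eq_of_zero k (m l r : M) : m = 0 -> l - r = k *: m -> l = r.
Proof. by move=> -> /eqP; rewrite scaler0 subr_eq0 => /eqP. Qed.

Lemma eq_of_scaled k (l r : M) : k *: (l - r) = 0 -> k != 0 -> l = r.
Proof. by move=> /eqP + k0; rewrite scaler_eq0 (negPf k0) subr_eq0 => /eqP. Qed.

Lemma eq_of_zero2 k1 k2 (m1 m2 l r : M) : m1 = 0 -> m2 = 0 ->
  l - r = k1 *: m1 + k2 *: m2 -> l = r.
Proof. by move=> -> -> /eqP; rewrite !scaler0 addr0 subr_eq0 => /eqP. Qed.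

End LinearCombination.

Ltac lc_index x env :=
  match env with
  | cons ?y _ => let _ := match constr:(Set) with _ => constr_eq x y end in constr:(O)
  | cons _ ?env' => let n := lc_index x env' in constr:(S n)
  end.
Ltac lc_atoms env t :=
  lazymatch t with
  | (?t1 + ?t2)%R => let env1 := lc_atoms env t1 in lc_atoms env1 t2
  | (- ?t1)%R => lc_atoms env t1
  | (_ *: ?t1)%R => lc_atoms env t1
  | 0%R => env
  | _ => match constr:(Set) with
         | _ => let _ := lc_index t env in env
         | _ => constr:(cons t env)
         end
  end.
Ltac lc_quote F env t :=
  lazymatch t with
  | (?t1 + ?t2)%R =>
      let q1 := lc_quote F env t1 in let q2 := lc_quote F env t2 in constr:(LAdd q1 q2)
  | (- ?t1)%R => let q1 := lc_quote F env t1 in constr:(LOpp q1)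
  | (?k *: ?t1)%R => let q1 := lc_quote F env t1 in constr:(@LScale F k q1)
  | 0%R => constr:(LZero F)
  | _ => let i := lc_index t env in constr:(LVar F i)
  end.
Ltac compare_coefs :=
  lazymatch goal with F : fieldType |- @eq ?T ?l ?r =>
    let env0 := constr:(@nil T) in
    let env1 := lc_atoms env0 l in
    let env := lc_atoms env1 r in
    let ql := lc_quote F env l in
    let qr := lc_quote F env r in
    refine (@lc_sameP F _ env ql qr _);
    cbv [size lc_same lc_coef eqn]; repeat split
  end.

Ltac nonzero := repeat (apply/andP; split); first [assumption | done].
Ltac by_combination k H := apply: (eq_of_zero (k := k) H); compare_coefs; field; nonzero.

(** * Linear maps given by a property *)

Section LinearMaps.
Variables (F : fieldType) (U W : lmodType F).

(** Bilinearity is stated for plain functions; this gives their partial maps the properties of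
    linear maps. *)
Definition linear_of (f : U -> W) (lf : linear f) : {linear U -> W} :=
  HB.pack f (GRing.isLinear.Build F U W _ f lf).

Lemma lin0 (f : U -> W) : linear f -> f 0 = 0.
Proof. by move=> lf; exact: (linear0 (linear_of lf)). Qed.
Lemma linD (f : U -> W) : linear f -> {morph f : x y / x + y}.
Proof. by move=> lf; exact: (linearD (linear_of lf)). Qed.
Lemma linN (f : U -> W) : linear f -> {morph f : x / - x}.
Proof. by move=> lf; exact: (linearN (linear_of lf)). Qed.
Lemma linZ (f : U -> W) k : linear f -> {morph f : x / k *: x}.
Proof. by move=> lf; exact: (linearZ_LR (linear_of lf)). Qed.
Lemma lin_sum (f : U -> W) I r (P : pred I) (g : I -> U) : linear f ->
  f (\sum_(i <- r | P i) g i) = \sum_(i <- r | P i) f (g i).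
Proof. by move=> lf; exact: (linear_sum (linear_of lf)). Qed.
End LinearMaps.

(** * Evaluating endomorphisms and volume forms *)

Section EndomorphismRules.
Variables (F : fieldType) (V : vectType F).
Local Notation slV := (subvs_of (sl V)).
Local Notation tr3 x y z := (endo_tr (vsval x \o (vsval y \o vsval z))%VF).

(** The values of covectors are typed in [F] and not in the module [F^o], so that products of
    scalars are seen as such. *)
Lemma pair0 (f : dual V) : (f 0 : F) = 0. Proof. by rewrite linear0. Qed.
Lemma end0 (x : 'End(V)) : x 0 = 0. Proof. by rewrite linear0. Qed.
Lemma pairD (f : dual V) (u v : V) : (f (u + v) : F) = (f u : F) + (f v : F).
Proof. by rewrite linearD. Qed.
Lemma pairN (f : dual V) (u : V) : (f (- u) : F) = - (f u : F).
Proof. by rewrite linearN. Qed.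
Lemma pairZ (f : dual V) k (u : V) : (f (k *: u) : F) = k * (f u : F).
Proof. by rewrite linearZ. Qed.
Lemma endD (x : 'End(V)) (u v : V) : x (u + v) = x u + x v.
Proof. by rewrite linearD. Qed.
Lemma endN (x : 'End(V)) (u : V) : x (- u) = - x u.
Proof. by rewrite linearN. Qed.
Lemma endZ (x : 'End(V)) k (u : V) : x (k *: u) = k *: x u.
Proof. by rewrite linearZ. Qed.
Definition pushE := (pairD, pairN, pairZ, endD, endN, endZ).

Lemma dual_actE (f : dual V) (x : slV) v : dual_act f x v = f (vsval x v).
Proof. by rewrite comp_lfunE. Qed.
Lemma sl_br_act (x y : slV) v : vsval (sl_br x y) v = vsval x (vsval y v) - vsval y (vsval x v).
Proof. by rewrite sl_brE add_lfunE opp_lfunE !comp_lfunE. Qed.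
Lemma sl_tr0 (x : slV) : endo_tr (vsval x) = 0.
Proof. by apply/eqP; rewrite -mem_sl subvsP. Qed.
Lemma tr3_cycle (x y z : slV) : tr3 y z x = tr3 x y z.
Proof. by rewrite [RHS]endo_trC comp_lfunA. Qed.
Lemma sl_form_br (x y z : slV) : sl_form x (sl_br y z) = 3%:R^-1 * (tr3 x y z - tr3 x z y).
Proof. by rewrite /sl_form sl_brE comp_lfunDr comp_lfunNr endo_trB. Qed.

Hypotheses (char3 : 3%N \notin [pchar F]) (dimV : \dim {:V} = 3%N).

Lemma sl_circ_act (x y : slV) v : vsval (sl_circ x y) v = vsval x (vsval y v) + vsval y (vsval x v)
  - (2%:R * sl_form x y) *: v.
Proof.
rewrite sl_circE // !(add_lfunE, opp_lfunE, scale_lfunE, id_lfunE, comp_lfunE).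
by rewrite /sl_form mulrA.
Qed.
Lemma sl_rank1_act u (g : dual V) v :
  vsval (sl_rank1 u g) v = (g v : F) *: u - (3%:R^-1 * (g u : F)) *: v.
Proof.
by rewrite sl_rank1E // !(add_lfunE, opp_lfunE, scale_lfunE, id_lfunE) rank1E.
Qed.
Lemma sl_form_circ (x y z : slV) : sl_form x (sl_circ y z) = 3%:R^-1 * (tr3 x y z + tr3 x z y).
Proof.
rewrite /sl_form sl_circE // comp_lfunDr comp_lfunNr comp_lfunDr -comp_lfunZr comp_lfun1r.
by rewrite endo_trB endo_trD endo_trZ sl_tr0 mulr0 subr0.
Qed.
Lemma sl_form_rank1 (x : slV) u (g : dual V) :
  sl_form x (sl_rank1 u g) = 3%:R^-1 * (g (vsval x u) : F).
Proof.
have E : (vsval x \o rank1 u g)%VF = rank1 (vsval x u) g.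
  by apply/lfunP => v; rewrite comp_lfunE !rank1E linearZ.
rewrite /sl_form sl_rank1E // comp_lfunDr comp_lfunNr -comp_lfunZr comp_lfun1r.
by rewrite endo_trB endo_trZ sl_tr0 mulr0 subr0 E endo_tr_rank1.
Qed.

End EndomorphismRules.

Section VolumeRules.
Variables (F : fieldType) (V : vectType F) (det : V -> V -> V -> F).
Implicit Types (f : dual V).
Local Notation slV := (subvs_of (sl V)).

Lemma pairing_detE f1 f2 f3 v1 v2 v3 : pairing_det f1 f2 f3 v1 v2 v3 =
  (f1 v1 : F) * (f2 v2 * f3 v3 - f2 v3 * f3 v2)
  - (f1 v2 : F) * (f2 v1 * f3 v3 - f2 v3 * f3 v1)
  + (f1 v3 : F) * (f2 v1 * f3 v2 - f2 v2 * f3 v1).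
Proof.
rewrite /pairing_det (expand_det_row _ 0) !big_ord_recl big_ord0 /cofactor.
rewrite !(@expand_det_row _ 2 _ ord0) !big_ord_recl !big_ord0 /cofactor.
rewrite !det_mx11 !mxE /= /bump /= !(addn0, add0n) !expr0 !expr1.
rewrite -[(1 + 1)%N]/2%N /= sqrrN expr1n.
ring.
Qed.

Lemma dual_det_swap f1 f2 f3 : dual_det det f2 f1 f3 = - dual_det det f1 f2 f3.
Proof. by rewrite -!dual_wedgeE (dual_wedge_anticomm det f2) linearN. Qed.
Lemma dual_det_cycle f1 f2 f3 : dual_det det f2 f3 f1 = dual_det det f1 f2 f3.
Proof. by rewrite /dual_det; congr (_ / _); rewrite !pairing_detE; ring. Qed.
Lemma dual_wedge_comp (f f1 f2 : dual V) (x : slV) :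
  (f (vsval x (dual_wedge det f1 f2)) : F) = dual_det det f1 f2 (dual_act f x).
Proof. by rewrite -dual_wedgeE comp_lfunE. Qed.

Hypothesis det_alt : alternating3 det.

Lemma det_swap u1 u2 v : det u2 u1 v = - det u1 u2 v.
Proof. by rewrite -!wedgeE // (wedge_anticomm det_alt u2) opp_lfunE. Qed.
Lemma det_cycle u1 u2 u3 : det u2 u3 u1 = det u1 u2 u3.
Proof.
have [_ l2 l3 alt] := det_alt.
have sw23 u v w : det u w v = - det u v w.
  have D2 p q r t : det p (q + r) t = det p q t + det p r t.
    by have := l2 p t 1 q r; rewrite scale1r mul1r.
  have D3 p q r t : det p t (q + r) = det p t q + det p t r.
    by have := l3 p t 1 q r; rewrite scale1r mul1r.
  have [_ _] := alt (v + w) u; have [_ _ y0] := alt v u; have [_ _ z0] := alt w u.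
  by rewrite D2 !D3 y0 z0 add0r addr0 addrC => /eqP; rewrite addr_eq0 => /eqP.
by rewrite sw23 (det_swap u1) opprK.
Qed.

End VolumeRules.

(** * Symmetric trilinear maps *)

(** The cubic form at [u + v + w], by inclusion and exclusion over the partial sums, is twice the
    cyclic sum, as [m] is symmetric; at [u = v = w] the cyclic sum is three times the cubic form. *)
Lemma cubic_polarized (F : fieldType) (U W M : lmodType F) (m : U -> U -> W) (D : U -> W -> M) :
  (2%:R : F) != 0 -> (3%:R : F) != 0 ->
  is_bilinear m -> (forall p q : U, m p q = m q p) -> is_bilinear D ->
  (forall u : U, D u (m u u) = 0) <->
  (forall u v w : U, D u (m v w) + D v (m w u) + D w (m u v) = 0).
Proof.
move=> two_neq0 three_neq0 bm msym bD; split=> [H u v w|H u]; last first.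
  by by_combination (3%:R^-1 : F) (H u u u).
have ml p q r : m (p + q) r = m p r + m q r := linD (bm.1 r) p q.
have mr p q r : m r (p + q) = m r p + m r q := linD (bm.2 r) p q.
have Dl p q r : D (p + q) r = D p r + D q r := linD (bD.1 r) p q.
have Dr p q r : D r (p + q) = D r p + D r q := linD (bD.2 r) p q.
have polar : 2%:R *: (D u (m v w) + D v (m w u) + D w (m u v)) =
    D (u + v + w) (m (u + v + w) (u + v + w)) - D (u + v) (m (u + v) (u + v))
    - D (u + w) (m (u + w) (u + w)) - D (v + w) (m (v + w) (v + w))
    + D u (m u u) + D v (m v v) + D w (m w w).
  rewrite !(ml, mr) !(Dl, Dr) (msym v u) (msym w v) (msym w u).
  compare_coefs; ring.
apply/eqP; move/eqP: polar; rewrite !H !subr0 !addr0 scaler_eq0 (negPf two_neq0); exact.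
Qed.

Lemma symmetric3_cyclic (M N : Type) (f : M -> M -> M -> N) :
  (forall p q r, f p r q = f p q r) -> (forall p q r, f q r p = f p q r) -> symmetric3 f.
Proof.
move=> swap cyc x y z; split.
- by rewrite swap cyc.
- exact: swap.
- by rewrite -cyc swap.
- exact: cyc.
- by rewrite -cyc.
Qed.

(** * Dual bases of a three-dimensional space *)

Section Frame.
Variables (F : fieldType) (V : vectType F).
Implicit Types (u v w : V) (f g : dual V) (x y z : 'End(V)).

(** The families are indexed by [nat], of which only [0], [1] and [2] matter, so that their
    members can be denoted by numerals. *)
Definition dual_bases3 (e : nat -> V) (eps : nat -> dual V) : Prop :=
  (forall i j, (i < 3)%N -> (j < 3)%N -> (eps i (e j) : F) = (i == j)%:R) /\
  (forall v, v = (eps 0%N v : F) *: e 0%N + (eps 1%N v : F) *: e 1%N + (eps 2%N v : F) *: e 2%N).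

Lemma dual_bases3_exist : \dim {:V} = 3%N -> exists e eps, dual_bases3 e eps.
Proof.
move=> dimV; have := vbasisP {:V}; move: (vbasis _); rewrite dimV => t tP.
have tfree := basis_free tP.
exists (fun i => t`_i), (fun i => linfun (coord t (inord i) : V -> F^o)); split.
  move=> i j lti ltj; rewrite lfunE /= -[j in t`_j](@inordK 2) //.
  by rewrite coord_free // eq_sym -val_eqE /= !inordK.
move=> v; rewrite [LHS](coord_basis tP (memvf _)) !big_ord_recl big_ord0 addr0 addrA.
by rewrite !lfunE /=; congr (_ *: _ + _ *: _ + _ *: _); congr (coord _ _ _);
  apply: val_inj; rewrite /= inordK.
Qed.

Variables (e : nat -> V) (eps : nat -> dual V).
Hypothesis frame : dual_bases3 e eps.
Local Notation e0 := (e 0%N). Local Notation e1 := (e 1%N). Local Notation e2 := (e 2%N).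
Local Notation p0 := (eps 0%N). Local Notation p1 := (eps 1%N). Local Notation p2 := (eps 2%N).

Lemma frame_pairing :
  ((eps 0%N (e 0%N) : F) = 1) * ((eps 0%N (e 1%N) : F) = 0) * ((eps 0%N (e 2%N) : F) = 0)
  * (((eps 1%N (e 0%N) : F) = 0) * ((eps 1%N (e 1%N) : F) = 1) * ((eps 1%N (e 2%N) : F) = 0))
  * (((eps 2%N (e 0%N) : F) = 0) * ((eps 2%N (e 1%N) : F) = 0) * ((eps 2%N (e 2%N) : F) = 1)).
Proof. by rewrite !frame.1. Qed.

Lemma pairing_coord f u : (f u : F) = f e0 * p0 u + f e1 * p1 u + f e2 * p2 u.
Proof.
rewrite [u in LHS]frame.2 !linearD !linearZ /=.
by congr (_ + _ + _); apply: mulrC.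
Qed.

Lemma endo_tr_coord x : endo_tr x = p0 (x e0) + p1 (x e1) + p2 (x e2).
Proof.
have {1}-> : x = rank1 (x e0) p0 + rank1 (x e1) p1 + rank1 (x e2) p2.
  apply/lfunP => v; rewrite [v in LHS]frame.2 !linearD !linearZ /=.
  by do 2!rewrite lfunE /=; rewrite !rank1E.
by rewrite !endo_trD !endo_tr_rank1.
Qed.

Variable det : V -> V -> V -> F.
Hypotheses (det_alt : alternating3 det) (dimV : \dim {:V} = 3%N).
Hypothesis det_neq0 : exists v1 v2 v3, det v1 v2 v3 != 0.

(** Both volume forms are determined up to a scalar, and the two scalars are inverse to each
    other. With this, every identity between them is a polynomial identity in coordinates. *)
Lemma det_coord : exists2 c : F, c != 0 &
  (forall v1 v2 v3, det v1 v2 v3 = c * pairing_det p0 p1 p2 v1 v2 v3) /\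
  (forall f1 f2 f3, dual_det det f1 f2 f3 = pairing_det f1 f2 f3 e0 e1 e2 / c).
Proof.
have E : dual_det det p0 p1 p2 * det e0 e1 e2 = 1.
  by rewrite dual_detE // pairing_detE !frame_pairing /=; ring.
have c_neq0 : det e0 e1 e2 != 0.
  by apply: contra_eq_neq E => ->; rewrite mulr0 eq_sym oner_neq0.
exists (det e0 e1 e2) => //; split=> [v1 v2 v3|f1 f2 f3].
  by rewrite -(dual_detE det_alt dimV) // mulrA [_ * dual_det _ _ _ _]mulrC E mul1r.
by rewrite -(dual_detE det_alt dimV) // mulfK.
Qed.

(** Cramer's rule: the alternating sum over four vectors vanishes in dimension three. *)
Lemma det_cramer u1 u2 u3 f v :
  f u1 * det u2 u3 v + f u2 * det u3 u1 v + f u3 * det u1 u2 v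
  = det u1 u2 u3 * (f v : F).
Proof.
have [c c_neq0 [detE dualdE]] := det_coord.
rewrite !detE !pairing_detE (pairing_coord f u1) (pairing_coord f u2).
rewrite (pairing_coord f u3) (pairing_coord f v); ring.
Qed.

Lemma dual_det_cramer f1 f2 f3 v f :
  (f1 v : F) * dual_det det f2 f3 f + (f2 v : F) * dual_det det f3 f1 f
  + (f3 v : F) * dual_det det f1 f2 f = dual_det det f1 f2 f3 * (f v : F).
Proof.
have [c c_neq0 [detE dualdE]] := det_coord.
rewrite !dualdE !pairing_detE (pairing_coord f1 v) (pairing_coord f2 v).
rewrite (pairing_coord f3 v) (pairing_coord f v); by field.
Qed.

(** The contraction [g ∧ (u1 ∧ u2) = g(u2) u1 - g(u1) u2], tested on the covector [f]. *)
Lemma dual_wedge_wedge g u1 u2 f :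
  (f (dual_wedge det g (wedge det u1 u2)) : F) = g u2 * f u1 - g u1 * f u2.
Proof.
have [c c_neq0 [detE dualdE]] := det_coord.
rewrite dual_wedgeE dualdE pairing_detE !wedgeE // !detE.
rewrite !pairing_detE !frame_pairing (pairing_coord g u1) (pairing_coord g u2).
rewrite (pairing_coord f u1) (pairing_coord f u2) /=.
by field.
Qed.

(** The contraction [u ∧ (f1 ∧ f2) = f2(u) f1 - f1(u) f2], tested on the vector [v]. *)
Lemma wedge_dual_wedge u f1 f2 v :
  (wedge det u (dual_wedge det f1 f2) v : F) = f2 u * f1 v - f1 u * f2 v.
Proof.
have [c c_neq0 [detE dualdE]] := det_coord.
rewrite wedgeE // detE pairing_detE !dual_wedgeE !dualdE.
rewrite !pairing_detE !frame_pairing (pairing_coord f1 u) (pairing_coord f2 u).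
rewrite (pairing_coord f1 v) (pairing_coord f2 v) /=.
by field.
Qed.

(** The trace is the infinitesimal change of volume: both sides are alternating in the [u]s, hence
    equal once they agree on a basis, where the left side reads off the diagonal of [x]. *)
Lemma det_trace x u1 u2 u3 :
  det (x u1) u2 u3 + det u1 (x u2) u3 + det u1 u2 (x u3) = endo_tr x * det u1 u2 u3.
Proof.
have [c c_neq0 [detE dualdE]] := det_coord.
have coord_x (i : nat) u :
    (eps i (x u) : F) = eps i (x e0) * p0 u + eps i (x e1) * p1 u + eps i (x e2) * p2 u.
  by have := pairing_coord (eps i \o x)%VF u; rewrite !comp_lfunE.
by rewrite !detE !pairing_detE endo_tr_coord !(coord_x _ u1) !(coord_x _ u2) !(coord_x _ u3); ring.
Qed.

Lemma dual_det_trace x f1 f2 f3 :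
  dual_det det (f1 \o x)%VF f2 f3 + dual_det det f1 (f2 \o x)%VF f3
  + dual_det det f1 f2 (f3 \o x)%VF = endo_tr x * dual_det det f1 f2 f3.
Proof.
have [c c_neq0 [detE dualdE]] := det_coord.
rewrite !dualdE !pairing_detE endo_tr_coord !comp_lfunE /=.
do ![rewrite (pairing_coord f1 (x _)) | rewrite (pairing_coord f2 (x _))
  | rewrite (pairing_coord f3 (x _))].
by field.
Qed.

Lemma pairing_comp_coord x f u :
  (f (x u) : F) = f (x e0) * p0 u + f (x e1) * p1 u + f (x e2) * p2 u.
Proof. by have := pairing_coord (f \o x)%VF u; rewrite !comp_lfunE. Qed.

Lemma endo_eqP (x y : 'End(V)) :
  (forall i j, (i < 3)%N -> (j < 3)%N -> (eps i (x (e j)) : F) = eps i (y (e j))) -> x = y.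
Proof.
move=> E; have Ee j : (j < 3)%N -> x (e j) = y (e j).
  by move=> lt_j; rewrite [LHS]frame.2 [RHS]frame.2 !E.
by apply/lfunP => v; rewrite (frame.2 v) !linearD !linearZ /= !Ee.
Qed.

(** The full polarization of [x^3 = tr(x^2)/2 x + tr(x^3)/3], the Cayley-Hamilton identity of a
    traceless endomorphism. *)
Lemma cayley_hamilton3 x y z : endo_tr x = 0 -> endo_tr y = 0 -> endo_tr z = 0 ->
  ((x \o (y \o z)) + (x \o (z \o y)) + (y \o (z \o x)) + (y \o (x \o z))
     + (z \o (x \o y)) + (z \o (y \o x)))%VF
  = endo_tr (y \o z)%VF *: x + endo_tr (z \o x)%VF *: y + endo_tr (x \o y)%VF *: z
   + (endo_tr (x \o (y \o z))%VF + endo_tr (x \o (z \o y))%VF) *: \1%VF.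
Proof.
rewrite !endo_tr_coord !comp_lfunE.
(* The three trace conditions are solved for the last diagonal entries. *)
have last (a b c : F) : a + b + c = 0 -> c = - (a + b).
  by rewrite addrC => /eqP; rewrite addr_eq0 => /eqP.
move=> /last tx /last ty /last tz; apply: endo_eqP => i j lti ltj.
rewrite !(add_lfunE, scale_lfunE, comp_lfunE, id_lfunE) !linearD !linearZ /=.
do 2!rewrite ?(pairing_comp_coord x _ (y _)) ?(pairing_comp_coord x _ (z _))
  ?(pairing_comp_coord y _ (x _)) ?(pairing_comp_coord y _ (z _))
  ?(pairing_comp_coord z _ (y _)) ?(pairing_comp_coord z _ (x _)).
rewrite /GRing.scale /= tx ty tz.
by case: i lti => [|[|[|]]] // _; case: j ltj => [|[|[|]]] // _;
  rewrite !frame_pairing /= ?tx ?ty ?tz; ring.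
Qed.

End Frame.

(** * Evaluations separate the points of the graded space *)

Section Separation.
Variables (F : fieldType) (U W : lmodType F).

Lemma functional_bilinear (g : U -> F) : scalar g -> is_bilinear (fun x (a : W) => g x *: a).
Proof.
move=> lg; split=> [a k x y|x k a b]; first by rewrite lg scalerDl scalerA.
by rewrite scalerDr !scalerA mulrC.
Qed.

(** Applying [phi_i ⊗ id] to [t] gives its coordinates: [t = sum_i u_i ⊗ (phi_i ⊗ id)(t)]. *)
Lemma tensor_separated (I : finType) (u : I -> U) (phi : I -> U -> F) (t : tensor U W) :
  (forall x, x = \sum_i phi i x *: u i) ->
  (forall i, tensor_lift (fun x a => phi i x *: a) t = 0) -> t = 0.
Proof.
move=> decomp t0; apply: tensor_eqP => Z f bf.
rewrite (lin0 (tensor_lift_linear bf)) /tensor_lift /formal_eval.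
transitivity (\sum_i f (u i) (tensor_lift (fun x a => phi i x *: a) t)).
  under [RHS]eq_bigr do rewrite /tensor_lift /formal_eval (lin_sum _ _ _ (bf.2 _)).
  rewrite exchange_big; apply: eq_bigr => -[x a] _ /=.
  rewrite {1}[x]decomp (lin_sum _ _ _ (bf.1 _)).
  by apply: eq_bigr => i _; rewrite (linZ _ (bf.1 _)) (linZ _ (bf.2 _)).
by apply: big1 => i _; rewrite t0 (lin0 (bf.2 _)).
Qed.
End Separation.

Section Evaluation.
Variables (F : fieldType) (V : vectType F) (A B C s : lmodType F).
Local Notation L := (graded V A B C s).
Implicit Types (p q : L).

(** The functionals [x |-> f (x v)] on sl(V), [u |-> f u] on V and [f |-> f v] on the dual of V,
    extended to the tensor products. *)
Definition evA (f : dual V) (v : V) p : A :=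
  tensor_lift (fun (x : subvs_of (sl V)) a => (f (vsval x v) : F) *: a) p.1.1.1.
Definition evB (f : dual V) p : B := tensor_lift (fun u b => (f u : F) *: b) p.1.1.2.
Definition evC (v : V) p : C := tensor_lift (fun (f : dual V) c => (f v : F) *: c) p.1.2.
Definition evS p : s := p.2.

Let bilA (f : dual V) (v : V) :
  is_bilinear (fun (x : subvs_of (sl V)) (a : A) => (f (vsval x v) : F) *: a).
Proof. by apply: functional_bilinear => k x y; rewrite linearP lfunE /= lfunE linearP. Qed.
Let bilB (f : dual V) : is_bilinear (fun u (b : B) => (f u : F) *: b).
Proof. by apply: functional_bilinear => k x y; rewrite linearP. Qed.
Let bilC (v : V) : is_bilinear (fun (f : dual V) (c : C) => (f v : F) *: c).
Proof. by apply: functional_bilinear => k x y; rewrite lfunE /= lfunE. Qed.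

Lemma evA_linear f v : linear (evA f v).
Proof.
move=> k p q; have E : (k *: p + q).1.1.1 = k *: p.1.1.1 + q.1.1.1 by [].
by rewrite /evA E (tensor_lift_linear (bilA f v)).
Qed.
Lemma evB_linear f : linear (evB f).
Proof.
move=> k p q; have E : (k *: p + q).1.1.2 = k *: p.1.1.2 + q.1.1.2 by [].
by rewrite /evB E (tensor_lift_linear (bilB f)).
Qed.
Lemma evC_linear v : linear (evC v).
Proof.
move=> k p q; have E : (k *: p + q).1.2 = k *: p.1.2 + q.1.2 by [].
by rewrite /evC E (tensor_lift_linear (bilC v)).
Qed.
Lemma evS_linear : linear evS. Proof. by []. Qed.

Lemma evA_inA f v x a : evA f v (inA B C s (pure x a)) = (f (vsval x v) : F) *: a.
Proof. exact: (tensor_lift_pure _ _ (bilA f v)). Qed.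
Lemma evB_inB f u b : evB f (inB A C s (pure u b)) = (f u : F) *: b.
Proof. exact: (tensor_lift_pure _ _ (bilB f)). Qed.
Lemma evC_inC v f c : evC v (inC A B s (pure f c)) = (f v : F) *: c.
Proof. exact: (tensor_lift_pure _ _ (bilC v)). Qed.
Lemma evS_inS d : evS (inS V A B C d) = d. Proof. by []. Qed.
Lemma evA_other f v :
  (forall t, evA f v (inB A C s t) = 0) * (forall t, evA f v (inC A B s t) = 0)
  * (forall d, evA f v (inS V A B C d) = 0).
Proof. by do !split=> *; exact: (lin0 (tensor_lift_linear (bilA f v))). Qed.
Lemma evB_other f :
  (forall t, evB f (inA B C s t) = 0) * (forall t, evB f (inC A B s t) = 0)
  * (forall d, evB f (inS V A B C d) = 0).
Proof. by do !split=> *; exact: (lin0 (tensor_lift_linear (bilB f))). Qed.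
Lemma evC_other v :
  (forall t, evC v (inA B C s t) = 0) * (forall t, evC v (inB A C s t) = 0)
  * (forall d, evC v (inS V A B C d) = 0).
Proof. by do !split=> *; exact: (lin0 (tensor_lift_linear (bilC v))). Qed.
Lemma evS_other : (forall t, evS (inA B C s t) = 0) * (forall t, evS (inB A C s t) = 0)
  * (forall t, evS (inC A B s t) = 0).
Proof. by []. Qed.

Lemma graded_separated p :
  (forall f v, evA f v p = 0) -> (forall f, evB f p = 0) -> (forall v, evC v p = 0) ->
  evS p = 0 -> p = 0.
Proof.
pose bas := vbasis {:V}.
pose cf i : dual V := linfun (coord bas i : V -> F^o).
have dec v : v = \sum_i (cf i v : F) *: bas`_i.
  rewrite [LHS](coord_basis (vbasisP _) (memvf v)).
  by apply: eq_bigr => i _; rewrite lfunE.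
have decC (f : dual V) : f = \sum_(i < \dim {:V}) (f bas`_i : F) *: cf i.
  apply/lfunP => v; rewrite {1}[v]dec linear_sum sum_lfunE.
  by apply: eq_bigr => i _; rewrite linearZ scale_lfunE [LHS]mulrC.
case: p => [[[tA tB] tC] d] A0 B0 C0 S0.
have -> : tB = 0 by apply: (tensor_separated dec) => i; exact: B0.
have -> : tC = 0 by apply: (tensor_separated decC) => i; exact: C0.
have -> : tA = 0; last by rewrite [d]S0.
(* A traceless x is the sum of the traceless parts of its entries in the e_i eps_j. *)
apply: (tensor_separated (I := ('I_(\dim {:V}) * 'I_(\dim {:V}))%type)
  (u := fun ij => vsproj (sl V) (rank1 bas`_ij.1 (cf ij.2)))
  (phi := fun ij x => (cf ij.1 (vsval x bas`_ij.2) : F))) => [x|ij]; last exact: A0.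
transitivity (\sum_(i < \dim {:V}) \sum_(j < \dim {:V})
    (cf i (vsval x bas`_j) : F) *: vsproj (sl V) (rank1 bas`_i (cf j))); last first.
  by rewrite pair_bigA.
rewrite -[LHS]vsvalK.
have {1}-> : vsval x = \sum_(i < \dim {:V}) \sum_(j < \dim {:V})
    (cf i (vsval x bas`_j) : F) *: rank1 bas`_i (cf j).
  apply/lfunP => v; rewrite [v in LHS]dec linear_sum exchange_big sum_lfunE.
  apply: eq_bigr => j _; rewrite linearZ /= sum_lfunE {1}[vsval x _]dec scaler_sumr.
  apply: eq_bigr => i _; rewrite scale_lfunE rank1E !scalerA mulrC //.
rewrite linear_sum; apply: eq_bigr => i _.
by rewrite linear_sum; apply: eq_bigr => j _; rewrite linearZ.
Qed.

End Evaluation.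

(** * Jacobiators *)

Lemma char_neq0 (F : fieldType) p : prime p -> p \notin [pchar F] -> (p%:R : F) != 0.
Proof. by move=> pr_p; apply: contra => p0; rewrite inE pr_p. Qed.

Section Jacobiator.
Variables (F : fieldType) (L : lmodType F) (br : L -> L -> L).
Hypotheses (br_bil : is_bilinear br) (br_anti : forall p q, br p q = - br q p).

Definition jacobiator p q r := br p (br q r) + br q (br r p) + br r (br p q).

Lemma jacobiator_cycle p q r : jacobiator q r p = jacobiator p q r.
Proof. by rewrite /jacobiator addrC addrA. Qed.

Lemma jacobiator_swap p q r : jacobiator q p r = - jacobiator p q r.
Proof.
have N u v : br u (- v) = - br u v := linN (br_bil.2 u) v.
rewrite /jacobiator (br_anti p r) (br_anti r q) (br_anti q p) !N.
compare_coefs; ring.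
Qed.

Lemma jacobiator_linear p q : linear (jacobiator p q).
Proof.
move=> k r r'; rewrite /jacobiator !br_bil.2 !br_bil.1 !br_bil.2.
compare_coefs; ring.
Qed.

Lemma jacobiator_spanned (T : Type) (g : T -> L) :
  (forall p, exists l, p = \sum_(t <- l) g t) ->
  (forall t t' t'', jacobiator (g t) (g t') (g t'') = 0) ->
  forall p q r, jacobiator p q r = 0.
Proof.
move=> span J0.
have step p q : (forall t, jacobiator p q (g t) = 0) -> forall r, jacobiator p q r = 0.
  move=> J1 r; have [l ->] := span r.
  by rewrite (lin_sum _ _ _ (jacobiator_linear p q)) big1.
have J1 t t' r : jacobiator (g t) (g t') r = 0 by apply: step => t''; exact: J0.
have J2 t q r : jacobiator (g t) q r = 0.
  rewrite -jacobiator_cycle -jacobiator_cycle; apply: step => t'.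
  by rewrite -jacobiator_cycle J1.
by move=> p q r; rewrite -jacobiator_cycle; apply: step => t; rewrite jacobiator_cycle J2.
Qed.

Lemma lie_bracketP : 2%:R != 0 :> F ->
  is_lie_bracket br <-> forall p q r, jacobiator p q r = 0.
Proof.
move=> two; split=> [[_ _ J]|J] //; split=> // p.
by have /eqP := br_anti p p; rewrite -addr_eq0 -mulr2n -scaler_nat scaler_eq0 (negPf two) => /eqP.
Qed.
End Jacobiator.

(** For an alternating condition on triples of elements that are sorted into types. *)
Lemma sorted_triples (T : Type) (ty : T -> nat) (P : T -> T -> T -> Prop) :
  (forall x y z, P x y z -> P y z x) -> (forall x y z, P x y z -> P y x z) ->
  (forall x y z, (ty x <= ty y)%N -> (ty y <= ty z)%N -> P x y z) ->
  forall x y z, P x y z.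
Proof.
move=> cyc swap sorted x y z.
have [xy|/ltnW yx] := leqP (ty x) (ty y); have [yz|/ltnW zy] := leqP (ty y) (ty z).
- exact: sorted.
- have [xz|/ltnW zx] := leqP (ty x) (ty z).
    exact/swap/cyc/cyc/sorted.
  exact/cyc/sorted.
- have [xz|/ltnW zx] := leqP (ty x) (ty z).
    exact/swap/sorted.
  exact/cyc/cyc/sorted.
- exact/swap/cyc/sorted.
Qed.

(** * The brackets of homogeneous elements *)

Section GradedJacobi.
Variables (F : fieldType) (V : vectType F) (A B C s : lmodType F).
Variables (det : V -> V -> V -> F) (X : coord_data A B C s).
Hypotheses (char2 : 2%N \notin [pchar F]) (char3 : 3%N \notin [pchar F]).
Hypotheses (dimV : \dim {:V} = 3%N) (det_alt : alternating3 det).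
Hypothesis det_neq0 : exists v1 v2 v3, det v1 v2 v3 != 0.
Variables (e : nat -> V) (eps : nat -> dual V).
Hypothesis frame : dual_bases3 e eps.
Let two_neq0 : (2%:R : F) != 0. Proof. exact: char_neq0 char2. Qed.
Let three_neq0 : (3%:R : F) != 0. Proof. exact: char_neq0 char3. Qed.
Local Notation slV := (subvs_of (sl V)).
Local Notation L := (graded V A B C s).

Inductive generator :=
  | GenA of slV & A | GenB of V & B | GenC of dual V & C | GenS of s.

Definition gen (g : generator) : L :=
  match g with
  | GenA x a => inA B C s (pure x a)
  | GenB u b => inB A C s (pure u b)
  | GenC f c => inC A B s (pure f c)
  | GenS d => inS V A B C d
  end.

Lemma gen_spanned (p : L) : exists l, p = \sum_(g <- l) gen g.
Proof.
case: p => [[[tA tB] tC] d].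
have [lA ->] := tensor_spanned tA; have [lB ->] := tensor_spanned tB.
have [lC ->] := tensor_spanned tC.
exists ([seq GenA z.1 z.2 | z <- lA] ++ [seq GenB z.1 z.2 | z <- lB]
  ++ [seq GenC z.1 z.2 | z <- lC] ++ [:: GenS d]).
rewrite !big_cat !big_map big_seq1 /= -(lin_sum _ _ _ (@inA_linear F V A B C s)).
rewrite -(lin_sum _ _ _ (@inB_linear F V A B C s)) -(lin_sum _ _ _ (@inC_linear F V A B C s)).
rewrite -[LHS]/(_,_,_,_); do !congr (_, _); rewrite /= ?addr0 ?add0r //.
Qed.

Lemma circE a a' : circ X a a' = altmul X a a' + altmul X a' a.
Proof.
rewrite /altmul (circ_comm X a' a) (comm_anticomm X a' a); compare_coefs; by field.
Qed.
Lemma commE a a' : comm X a a' = altmul X a a' - altmul X a' a.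
Proof.
rewrite /altmul (circ_comm X a' a) (comm_anticomm X a' a); compare_coefs; by field.
Qed.

(** The bracket unfolds to a sum over the pairs of components, which the rules for [br p (q + r)]
    would match. Behind an opaque proof it is known by its values on homogeneous elements only. *)
Fact sealed_bracket : {br : L -> L -> L | br = bracket det X}.
Proof. by exists (bracket det X). Qed.
Definition gbracket : L -> L -> L := sval sealed_bracket.
Lemma gbracketE : gbracket = bracket det X. Proof. exact: (svalP sealed_bracket). Qed.
Lemma gbracket_bilinear : is_bilinear gbracket.
Proof. by rewrite gbracketE; exact: bracket_bilinear. Qed.
Local Notation br := gbracket.
Local Notation tA x a := (inA B C s (pure x a)).
Local Notation tB u b := (inB A C s (pure u b)).
Local Notation tC f c := (inC A B s (pure f c)).
Local Notation tS d := (inS V A B C d).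

Lemma brDr p q r : br p (q + r) = br p q + br p r.
Proof. exact: (linD (gbracket_bilinear.2 p)). Qed.
Lemma brNr p q : br p (- q) = - br p q.
Proof. exact: (linN (gbracket_bilinear.2 p)). Qed.
Lemma brC p q : br p q = - br q p. Proof. by rewrite gbracketE; exact: bracket_anticomm. Qed.

Lemma br_BA u b x a : br (tB u b) (tA x a) = - tB (sl_act x u) (lmulB X a b).
Proof. by rewrite brC gbracketE bracket_AB. Qed.
Lemma br_AC f c x a : br (tA x a) (tC f c) = - tC (dual_act f x) (rmulC X c a).
Proof. by rewrite brC gbracketE bracket_CA. Qed.
Lemma br_CB u b f c : br (tC f c) (tB u b) =
  - (tA (sl_rank1 u f) (TBC X b c) + tS ((3%:R^-1 * (f u : F)) *: DBC X b c)).
Proof. by rewrite brC gbracketE bracket_BC. Qed.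
Lemma br_AS d x a : br (tA x a) (tS d) = - tA x (sA X d a).
Proof. by rewrite brC gbracketE bracket_SA. Qed.
Lemma br_BS d u b : br (tB u b) (tS d) = - tB u (sB X d b).
Proof. by rewrite brC gbracketE bracket_SB. Qed.
Lemma br_CS d f c : br (tC f c) (tS d) = - tC f (sC X d c).
Proof. by rewrite brC gbracketE bracket_SC. Qed.

Lemma br_AA x y a a' : br (tA x a) (tA y a') =
  tA (sl_br x y) (2%:R^-1 *: circ X a a') + tA (sl_circ x y) (2%:R^-1 *: comm X a a')
  + tS (sl_form x y *: DA X a a').
Proof. by rewrite gbracketE bracket_AA. Qed.
Lemma br_AB x a u b : br (tA x a) (tB u b) = tB (sl_act x u) (lmulB X a b).
Proof. by rewrite gbracketE bracket_AB. Qed.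
Lemma br_CA x a f c : br (tC f c) (tA x a) = tC (dual_act f x) (rmulC X c a).
Proof. by rewrite gbracketE bracket_CA. Qed.
Lemma br_BC u b f c : br (tB u b) (tC f c) =
  tA (sl_rank1 u f) (TBC X b c) + tS ((3%:R^-1 * (f u : F)) *: DBC X b c).
Proof. by rewrite gbracketE bracket_BC. Qed.
Lemma br_BB u u' b b' : br (tB u b) (tB u' b') = tC (wedge det u u') (crossB X b b').
Proof. by rewrite gbracketE bracket_BB. Qed.
Lemma br_CC f f' c c' : br (tC f c) (tC f' c') = tB (dual_wedge det f f') (crossC X c c').
Proof. by rewrite gbracketE bracket_CC. Qed.
Lemma br_SA x a d : br (tS d) (tA x a) = tA x (sA X d a).
Proof. by rewrite gbracketE bracket_SA. Qed.
Lemma br_SB u b d : br (tS d) (tB u b) = tB u (sB X d b).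
Proof. by rewrite gbracketE bracket_SB. Qed.
Lemma br_SC f c d : br (tS d) (tC f c) = tC f (sC X d c).
Proof. by rewrite gbracketE bracket_SC. Qed.
Lemma br_SS d d' : br (tS d) (tS d') = tS (sbr X d d').
Proof. by rewrite gbracketE bracket_SS. Qed.
Definition brE := (brDr, brNr, br_AA, br_AB, br_BA, br_BB, br_CC, br_BC, br_CA, br_AC, br_CB,
  br_AS, br_BS, br_CS, br_SA, br_SB, br_SC, br_SS).


Definition evD :=
((fun f v => linD (@evA_linear F V A B C s f v)), (fun f v => linN (@evA_linear F V A B C s f v)),
 (fun f v => lin0 (@evA_linear F V A B C s f v)),
 (fun f => linD (@evB_linear F V A B C s f)), (fun f => linN (@evB_linear F V A B C s f)),
 (fun f => lin0 (@evB_linear F V A B C s f)),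
 (fun v => linD (@evC_linear F V A B C s v)), (fun v => linN (@evC_linear F V A B C s v)),
 (fun v => lin0 (@evC_linear F V A B C s v)),
 linD (@evS_linear F V A B C s), linN (@evS_linear F V A B C s)).
Definition evE := (evD, @evA_inA F V A B C s, @evB_inB F V A B C s, @evC_inC F V A B C s,
  @evS_inS F V A B C s, @evA_other F V A B C s, @evB_other F V A B C s, @evC_other F V A B C s,
  @evS_other F V A B C s).

Local Notation J := (jacobiator br).
Local Notation am := (altmul X).
Local Notation tr3 x y z := (endo_tr (vsval x \o (vsval y \o vsval z))%VF).

Lemma graded_eq0P (p : L) : p = 0 <->
  [/\ forall f v, evA f v p = 0, forall f, evB f p = 0, forall v, evC v p = 0 & evS p = 0].
Proof.
split=> [->|[]]; last exact: graded_separated.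
by split=> *; rewrite ?(lin0 (evA_linear _ _)) ?(lin0 (evB_linear _)) ?(lin0 (evC_linear _)).
Qed.

Lemma altmul_bilinear : is_bilinear am.
Proof.
split=> a k x y; rewrite /altmul ?linearPl ?linearPr; compare_coefs; ring.
Qed.
Definition altmulE := ((fun a => linD (altmul_bilinear.1 a)), (fun a => linD (altmul_bilinear.2 a)),
 (fun a => linN (altmul_bilinear.1 a)), (fun a => linN (altmul_bilinear.2 a)),
 (fun a k => linZ k (altmul_bilinear.1 a)), (fun a k => linZ k (altmul_bilinear.2 a))).

Definition actionE := (dual_wedge_comp det, wedgeE det_alt, dual_wedgeE det, @sl_br_act F V,
  sl_circ_act char3 dimV, sl_rank1_act char3 dimV, @dual_actE F V).

(** * The Jacobiators of homogeneous elements *)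

Implicit Types (x y z : slV) (u v : V) (f g : dual V).

(** A Jacobiator of homogeneous elements lies in one of V ⊗ B, dual V ⊗ C and sl(V) ⊗ A + s; in the
    three lemmas the remaining evaluations are supposed to vanish. *)
Lemma zero_inB (p : L) (R : dual V -> B) :
  (forall f, evB f p = R f) -> (forall f v, evA f v p = 0) -> (forall v, evC v p = 0) ->
  evS p = 0 -> (p = 0 <-> forall f, R f = 0).
Proof.
move=> E A0 C0 S0; rewrite graded_eq0P; split=> [[_ H _ _] f|H]; first by rewrite -E.
by split=> // f; rewrite E.
Qed.
Lemma zero_inC (p : L) (R : V -> C) :
  (forall v, evC v p = R v) -> (forall f v, evA f v p = 0) -> (forall f, evB f p = 0) ->
  evS p = 0 -> (p = 0 <-> forall v, R v = 0).
Proof.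
move=> E A0 C0 S0; rewrite graded_eq0P; split=> [[_ _ H _] f|H]; first by rewrite -E.
by split=> // f; rewrite E.
Qed.
Lemma zero_inAS (p : L) (R : dual V -> V -> A) (S : s) :
  (forall f v, evA f v p = R f v) -> evS p = S ->
  (forall f, evB f p = 0) -> (forall v, evC v p = 0) ->
  (p = 0 <-> (forall f v, R f v = 0) /\ S = 0).
Proof.
move=> E ES B0 C0; rewrite graded_eq0P; split=> [[H _ _ HS]|[H HS]].
  by split=> [f v|]; rewrite -?E -?ES.
by split=> // [f v|]; rewrite ?E ?ES.
Qed.

Ltac ev_vanishes := by move=> *; rewrite /jacobiator !brE !evE /=; compare_coefs; ring.
Ltac ev_expand := rewrite /jacobiator !brE !evE /sl_act; try rewrite !actionE.

Lemma jacobiator_SSS d d' d'' : J (tS d) (tS d') (tS d'') = 0 <-> jacobiator (sbr X) d d' d'' = 0.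
Proof.
transitivity ((forall f v, (0 : A) = 0) /\ jacobiator (sbr X) d d' d'' = 0).
  by apply: zero_inAS; [ev_vanishes|ev_expand|ev_vanishes|ev_vanishes].
by split=> [[]|].
Qed.

Lemma jacobiator_SSA d d' x a : J (tS d) (tS d') (tA x a) = 0 <->
  forall f v, (f (vsval x v) : F) *:
    (sA X (sbr X d d') a - (sA X d (sA X d' a) - sA X d' (sA X d a))) = 0.
Proof.
transitivity ((forall f v, - ((f (vsval x v) : F) *:
  (sA X (sbr X d d') a - (sA X d (sA X d' a) - sA X d' (sA X d a)))) = 0) /\ (0 : s) = 0).
  apply: zero_inAS; [move=> f v; ev_expand; compare_coefs; ring|ev_vanishes ..].
by split=> [[H _] f v|H]; [apply/eqP; rewrite -oppr_eq0 H|split=> // f v; rewrite H oppr0].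
Qed.

Lemma jacobiator_SSB d d' u b : J (tS d) (tS d') (tB u b) = 0 <->
  forall f, (f u : F) *: (sB X d (sB X d' b) - sB X d' (sB X d b) - sB X (sbr X d d') b) = 0.
Proof. apply: zero_inB; [move=> f; ev_expand; compare_coefs; ring|ev_vanishes ..]. Qed.

Lemma jacobiator_SSC d d' g c : J (tS d) (tS d') (tC g c) = 0 <->
  forall v, (g v : F) *: (sC X d (sC X d' c) - sC X d' (sC X d c) - sC X (sbr X d d') c) = 0.
Proof. apply: zero_inC; [move=> f; ev_expand; compare_coefs; ring|ev_vanishes ..]. Qed.

Lemma jacobiator_SAB d x a u b : J (tS d) (tA x a) (tB u b) = 0 <->
  forall f, (f (vsval x u) : F) *:
    (sB X d (lmulB X a b) - (lmulB X (sA X d a) b + lmulB X a (sB X d b))) = 0.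
Proof. apply: zero_inB; [move=> f; ev_expand; compare_coefs; ring|ev_vanishes ..]. Qed.

Lemma jacobiator_SAC d x a g c : J (tS d) (tA x a) (tC g c) = 0 <->
  forall v, - (g (vsval x v) : F) *:
    (sC X d (rmulC X c a) - (rmulC X (sC X d c) a + rmulC X c (sA X d a))) = 0.
Proof. apply: zero_inC; [move=> f; ev_expand; compare_coefs; ring|ev_vanishes ..]. Qed.

Lemma jacobiator_SBB d u1 b1 u2 b2 : J (tS d) (tB u1 b1) (tB u2 b2) = 0 <->
  forall v, det u1 u2 v *:
    (sC X d (crossB X b1 b2) - (crossB X (sB X d b1) b2 + crossB X b1 (sB X d b2))) = 0.
Proof.
apply: zero_inC; [move=> v|ev_vanishes ..].
ev_expand; rewrite (det_swap det_alt u1) (crossB_sym X b2); compare_coefs; ring.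
Qed.

Lemma jacobiator_SCC d f1 c1 f2 c2 : J (tS d) (tC f1 c1) (tC f2 c2) = 0 <->
  forall f, dual_det det f1 f2 f *:
    (sB X d (crossC X c1 c2) - (crossC X (sC X d c1) c2 + crossC X c1 (sC X d c2))) = 0.
Proof.
apply: zero_inB; [move=> v|ev_vanishes ..].
ev_expand; rewrite (dual_det_swap det f1) (crossC_sym X c2); compare_coefs; ring.
Qed.

Ltac bilin := try rewrite !(linearZl_LR, linearZr_LR, linearDl, linearDr, linearNl, linearNr) /=.

Lemma jacobiator_SBC d u b g c : J (tS d) (tB u b) (tC g c) = 0 <->
  (forall f v, ((g v : F) * f u - 3%:R^-1 * g u * f v) *:
    (sA X d (TBC X b c) - (TBC X (sB X d b) c + TBC X b (sC X d c))) = 0)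
  /\ (3%:R^-1 * (g u : F)) *: (sbr X d (DBC X b c) - (DBC X (sB X d b) c + DBC X b (sC X d c))) = 0.
Proof.
apply: zero_inAS; [move=> f v; ev_expand; rewrite !(@pushE F V); compare_coefs; ring
 |ev_expand; bilin; compare_coefs; ring|ev_vanishes|ev_vanishes].
Qed.

(** The first two terms are [xyu ⊗ (a(a'b) - (aa')b)] and the same with the two factors exchanged.
    The third comes from the components [- (x|y) 1 ⊗ [a,a']] and [(x|y) D_(a,a')] of the bracket
    of [x ⊗ a] and [y ⊗ a']. *)
Lemma jacobiator_AAB x a y a' u b : J (tA x a) (tA y a') (tB u b) = 0 <-> forall f,
  (f (vsval x (vsval y u)) : F) *: (lmulB X a (lmulB X a' b) - lmulB X (am a a') b)
  - (f (vsval y (vsval x u)) : F) *: (lmulB X a' (lmulB X a b) - lmulB X (am a' a) b)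
  + (sl_form x y * f u) *: (lmulB X (comm X a a') b - sB X (DA X a a') b) = 0.
Proof.
apply: zero_inB; [move=> f; ev_expand|ev_vanishes ..].
rewrite /altmul (circ_comm X a' a) (comm_anticomm X a' a); bilin; rewrite !(@pushE F V).
compare_coefs; by field.
Qed.

Lemma jacobiator_AAC x a y a' g c : J (tA x a) (tA y a') (tC g c) = 0 <-> forall v,
  (g (vsval y (vsval x v)) : F) *: (rmulC X (rmulC X c a') a - rmulC X c (am a' a))
  - (g (vsval x (vsval y v)) : F) *: (rmulC X (rmulC X c a) a' - rmulC X c (am a a'))
  - (sl_form x y * g v) *: (rmulC X c (comm X a a') + sC X (DA X a a') c) = 0.
Proof.
apply: zero_inC; [move=> v; ev_expand|ev_vanishes ..].
rewrite /altmul (circ_comm X a' a) (comm_anticomm X a' a); bilin; rewrite !(@pushE F V).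
compare_coefs; by field.
Qed.

Lemma jacobiator_ABB x a u1 b1 u2 b2 : J (tA x a) (tB u1 b1) (tB u2 b2) = 0 <-> forall v,
  - (det u1 u2 (vsval x v) *: rmulC X (crossB X b1 b2) a)
  - det u1 (vsval x u2) v *: crossB X b1 (lmulB X a b2)
  - det (vsval x u1) u2 v *: crossB X (lmulB X a b1) b2 = 0.
Proof.
apply: zero_inC; [move=> v; ev_expand|ev_vanishes ..].
rewrite (det_swap det_alt _ u2) (crossB_sym X b2); compare_coefs; ring.
Qed.

Lemma jacobiator_ABC x a u b g c : J (tA x a) (tB u b) (tC g c) = 0 <->
  (forall f v, (g v * f (vsval x u) : F) *: (am a (TBC X b c) - TBC X (lmulB X a b) c)
   + (g (vsval x v) * f u : F) *: (TBC X b (rmulC X c a) - am (TBC X b c) a)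
   + (3%:R^-1 * g (vsval x u) * f v : F) *:
       (TBC X (lmulB X a b) c - TBC X b (rmulC X c a) - comm X a (TBC X b c))
   - (3%:R^-1 * g u * f (vsval x v) : F) *: (comm X a (TBC X b c) + sA X (DBC X b c) a) = 0)
  /\ (3%:R^-1 * g (vsval x u) : F) *:
       (DA X a (TBC X b c) + DBC X b (rmulC X c a) - DBC X (lmulB X a b) c) = 0.
Proof.
apply: zero_inAS; [move=> f v; ev_expand|ev_expand|ev_vanishes|ev_vanishes].
- rewrite /altmul (circ_comm X _ a) (comm_anticomm X _ a) sl_form_rank1 //; bilin.
  rewrite !(@pushE F V); compare_coefs; field; by rewrite ?two_neq0 ?three_neq0.
- rewrite sl_form_rank1 //; compare_coefs; ring.
Qed.

Lemma jacobiator_ACC x a f1 c1 f2 c2 : J (tA x a) (tC f1 c1) (tC f2 c2) = 0 <-> forall f,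
  dual_det det f1 f2 (dual_act f x) *: lmulB X a (crossC X c1 c2)
  + dual_det det f1 (dual_act f2 x) f *: crossC X c1 (rmulC X c2 a)
  + dual_det det (dual_act f1 x) f2 f *: crossC X (rmulC X c1 a) c2 = 0.
Proof.
apply: zero_inB; [move=> f; ev_expand|ev_vanishes ..].
rewrite (dual_det_swap det _ f2) (crossC_sym X c2); compare_coefs; ring.
Qed.

Lemma jacobiator_BBB u1 b1 u2 b2 u3 b3 : J (tB u1 b1) (tB u2 b2) (tB u3 b3) = 0 <->
  (forall f v,
    (f u1 * det u2 u3 v - 3%:R^-1 * det u1 u2 u3 * f v) *: TBC X b1 (crossB X b2 b3)
  + (f u2 * det u3 u1 v - 3%:R^-1 * det u1 u2 u3 * f v) *: TBC X b2 (crossB X b3 b1)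
  + (f u3 * det u1 u2 v - 3%:R^-1 * det u1 u2 u3 * f v) *: TBC X b3 (crossB X b1 b2) = 0)
  /\ (3%:R^-1 * det u1 u2 u3) *: (DBC X b1 (crossB X b2 b3) + DBC X b2 (crossB X b3 b1)
        + DBC X b3 (crossB X b1 b2)) = 0.
Proof.
apply: zero_inAS; [move=> f v; ev_expand|ev_expand|ev_vanishes|ev_vanishes].
- rewrite (det_cycle det_alt u1 u2 u3) -(det_cycle det_alt u3 u1 u2) !(@pushE F V).
  compare_coefs; ring.
- rewrite (det_cycle det_alt u1 u2 u3) -(det_cycle det_alt u3 u1 u2); compare_coefs; ring.
Qed.

Lemma jacobiator_CCC f1 c1 f2 c2 f3 c3 : J (tC f1 c1) (tC f2 c2) (tC f3 c3) = 0 <->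
  (forall f v,
   - ((f1 v * dual_det det f2 f3 f - 3%:R^-1 * dual_det det f1 f2 f3 * f v) *:
        TBC X (crossC X c2 c3) c1)
  - (f2 v * dual_det det f3 f1 f - 3%:R^-1 * dual_det det f1 f2 f3 * f v) *:
        TBC X (crossC X c3 c1) c2
  - (f3 v * dual_det det f1 f2 f - 3%:R^-1 * dual_det det f1 f2 f3 * f v) *:
        TBC X (crossC X c1 c2) c3 = 0)
  /\ - (3%:R^-1 * dual_det det f1 f2 f3) *: (DBC X (crossC X c2 c3) c1 + DBC X (crossC X c3 c1) c2
        + DBC X (crossC X c1 c2) c3) = 0.
Proof.
apply: zero_inAS; [move=> f v; ev_expand|ev_expand|ev_vanishes|ev_vanishes].
- rewrite !(@pushE F V); try rewrite !actionE.
  rewrite (dual_det_cycle det f1 f2 f3) -(dual_det_cycle det f3 f1 f2).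
  compare_coefs; ring.
- rewrite (dual_det_cycle det f1 f2 f3) -(dual_det_cycle det f3 f1 f2); compare_coefs; ring.
Qed.

(** As [[u2 ⊗ b2, g ⊗ c]] has the component [- 1/3 g(u2) T(b2,c)] along the identity of V, each of
    [g(u2) u1] and [g(u1) u2] gets contributions of all three double brackets. *)
Lemma jacobiator_BBC u1 b1 u2 b2 g c : J (tB u1 b1) (tB u2 b2) (tC g c) = 0 <-> forall f,
  (g u2 * f u1 : F) *: (crossC X (crossB X b1 b2) c + 3%:R^-1 *: lmulB X (TBC X b2 c) b1
     - 3%:R^-1 *: sB X (DBC X b2 c) b1 + lmulB X (TBC X b1 c) b2)
  - (g u1 * f u2 : F) *: (crossC X (crossB X b1 b2) c + 3%:R^-1 *: lmulB X (TBC X b1 c) b2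
     - 3%:R^-1 *: sB X (DBC X b1 c) b2 + lmulB X (TBC X b2 c) b1) = 0.
Proof.
apply: zero_inB; [move=> f|ev_vanishes ..].
rewrite /jacobiator !brE !evE (dual_wedge_wedge frame det_alt dimV det_neq0) /sl_act.
try rewrite !actionE.
rewrite (crossC_sym X c); bilin; rewrite !(@pushE F V).
compare_coefs; ring.
Qed.

Lemma jacobiator_BCC u b g1 c1 g2 c2 : J (tB u b) (tC g1 c1) (tC g2 c2) = 0 <-> forall v,
  (g2 u * g1 v : F) *: (crossB X b (crossC X c1 c2) + 3%:R^-1 *: rmulC X c1 (TBC X b c2)
     + 3%:R^-1 *: sC X (DBC X b c2) c1 + rmulC X c2 (TBC X b c1))
  - (g1 u * g2 v : F) *: (crossB X b (crossC X c1 c2) + 3%:R^-1 *: rmulC X c2 (TBC X b c1)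
     + 3%:R^-1 *: sC X (DBC X b c1) c2 + rmulC X c1 (TBC X b c2)) = 0.
Proof.
apply: zero_inC; [move=> v|ev_vanishes ..].
rewrite /jacobiator !brE !evE (wedge_dual_wedge frame det_alt dimV det_neq0) /sl_act.
try rewrite !actionE.
bilin; rewrite !(@pushE F V).
compare_coefs; ring.
Qed.
(** It is this defect for the product of A that appears below, rather than those of its symmetric
    and skew parts. *)
Definition derivation_defect d a a' : A := sA X d (am a a') - (am (sA X d a) a' + am a (sA X d a')).

Lemma jacobiator_SAA d x a y a' : J (tS d) (tA x a) (tA y a') = 0 <->
  (forall f v, (f (vsval x (vsval y v)) : F) *: derivation_defect d a a'
     - (f (vsval y (vsval x v)) : F) *: derivation_defect d a' a
     - (sl_form x y * f v) *: (derivation_defect d a a' - derivation_defect d a' a) = 0)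
  /\ sl_form x y *: (sbr X d (DA X a a') - (DA X (sA X d a) a' + DA X a (sA X d a'))) = 0.
Proof.
apply: zero_inAS; [move=> f v; ev_expand|ev_expand|ev_vanishes|ev_vanishes];
  rewrite ?(sl_form_comm y x) /derivation_defect /altmul.
- rewrite (circ_comm X a' a) (circ_comm X a' (sA X d a)) (circ_comm X (sA X d a') a).
  rewrite (comm_anticomm X a' a) (comm_anticomm X a' (sA X d a)) (comm_anticomm X (sA X d a') a).
  bilin; rewrite !(@pushE F V); compare_coefs; by field.
- rewrite (DA_skew X a' (sA X d a)); bilin; compare_coefs; ring.
Qed.

Definition associator a b c : A := am (am a b) c - am a (am b c).
(** The coefficient of [- (y|z) x] in the Jacobiator of [x ⊗ a], [y ⊗ b], [z ⊗ c]. *)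
Definition nested_action a b c : A := comm X a (comm X b c) + sA X (DA X b c) a.
Definition cyclic_comm a b c : A := comm X a (am b c) + comm X b (am c a) + comm X c (am a b).
Definition cyclic_DA a b c : s := DA X a (am b c) + DA X b (am c a) + DA X c (am a b).

(** In End(V) ⊗ A the component of the bracket along sl(V) is
    [xy ⊗ ab - yx ⊗ ba - (x|y) 1 ⊗ (ab - ba)]: the corrections to trace zero gather in one term. *)
Lemma evA_AA f v x a y b : evA f v (br (tA x a) (tA y b)) =
  (f (vsval x (vsval y v)) : F) *: am a b - (f (vsval y (vsval x v)) : F) *: am b a
   - (sl_form x y * f v) *: (am a b - am b a).
Proof.
rewrite brE !evE !actionE !(@pushE F V) circE commE.
compare_coefs; by field.
Qed.
Lemma evS_AA x a y b : evS (br (tA x a) (tA y b)) = sl_form x y *: DA X a b.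
Proof. by rewrite brE !evE !add0r. Qed.

(** In End(V) ⊗ A the Jacobiator is a sum over the orderings of x, y, z of products [xyz] with
    associators as coefficients, a multiple of the identity, and the terms [(y|z) x]. *)
Lemma jacobiator_AAA x a y b z c : J (tA x a) (tA y b) (tA z c) = 0 <->
  (forall f v,
     - ((f (vsval x (vsval y (vsval z v))) : F) *: associator a b c
      + (f (vsval y (vsval z (vsval x v))) : F) *: associator b c a
      + (f (vsval z (vsval x (vsval y v))) : F) *: associator c a b)
     + (f (vsval x (vsval z (vsval y v))) : F) *: associator a c b
     + (f (vsval y (vsval x (vsval z v))) : F) *: associator b a c
     + (f (vsval z (vsval y (vsval x v))) : F) *: associator c b a
     - (3%:R^-1 * tr3 x y z * f v) *: cyclic_comm a b c
     + (3%:R^-1 * tr3 x z y * f v) *: cyclic_comm a c b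
     - (sl_form y z * f (vsval x v)) *: nested_action a b c
     - (sl_form z x * f (vsval y v)) *: nested_action b c a
     - (sl_form x y * f (vsval z v)) *: nested_action c a b = 0)
  /\ (3%:R^-1 * tr3 x y z) *: cyclic_DA a b c - (3%:R^-1 * tr3 x z y) *: cyclic_DA a c b = 0.
Proof.
have key f v p x' y' z' a' b' c' : p = br (tA x' a') (br (tA y' b') (tA z' c')) ->
  evA f v p =
  (f (vsval x' (vsval y' (vsval z' v))) : F) *: am a' (am b' c')
  - (f (vsval y' (vsval z' (vsval x' v))) : F) *: am (am b' c') a'
  - (f (vsval x' (vsval z' (vsval y' v))) : F) *: am a' (am c' b')
  + (f (vsval z' (vsval y' (vsval x' v))) : F) *: am (am c' b') a'
  - (3%:R^-1 * tr3 x' y' z' * f v) *: comm X a' (am b' c')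
  + (3%:R^-1 * tr3 x' z' y' * f v) *: comm X a' (am c' b')
  - (sl_form y' z' * f (vsval x' v)) *: nested_action a' b' c'.
  move=> ->; rewrite br_AA.
  rewrite !brDr !evD !evA_AA br_AS.
  rewrite !evE !actionE.
  rewrite sl_form_br sl_form_circ // !(@pushE F V) linearZl_LR /= /nested_action.
  rewrite !(circE, commE) !altmulE.
  rewrite (circ_comm X c' b') (comm_anticomm X c' b') !altmulE.
  compare_coefs; field; by rewrite ?two_neq0 ?three_neq0.
have keyS : forall p q r a' b' c',
  evS (br (tA p a') (br (tA q b') (tA r c'))) =
  (3%:R^-1 * tr3 p q r) *: DA X a' (am b' c') - (3%:R^-1 * tr3 p r q) *: DA X a' (am c' b').
  move=> p q r a' b' c'; rewrite br_AA.
  rewrite !brDr !evD !evS_AA br_AS !evE.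
  rewrite sl_form_br sl_form_circ // /altmul (circ_comm X c' b') (comm_anticomm X c' b').
  bilin; compare_coefs; field; by rewrite ?two_neq0 ?three_neq0.
apply: zero_inAS => [f v||f|v]; [| |ev_vanishes|ev_vanishes].
- rewrite /jacobiator !evD !(key _ _ _ _ _ _ _ _ _ erefl) /associator /cyclic_comm.
  rewrite (tr3_cycle x y z) -(tr3_cycle z x y) (tr3_cycle x z y) -(tr3_cycle y x z).
  compare_coefs; ring.
- rewrite /jacobiator !evD !keyS /cyclic_DA.
  rewrite (tr3_cycle x y z) -(tr3_cycle z x y) (tr3_cycle x z y) -(tr3_cycle y x z).
  compare_coefs; ring.
Qed.

(** * The conditions imposed by the Jacobi identity *)

(* The matrix unit e_i eps_j, made traceless. *)
Local Notation E i j := (sl_rank1 (e i%N) (eps j%N)).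
(** The rules for [0] and [1] come first: most terms vanish before they are expanded. *)
Definition evaluateE := (frame_pairing frame, mul0r, mulr0, mul1r, mulr1, scale0r, scale1r,
  scaler0, subr0, sub0r, oppr0, addr0, add0r, @pair0 F V, @end0 F V, comp_lfunE,
  sl_form_rank1 char3 dimV, sl_rank1_act char3 dimV, @pushE F V, endo_tr_coord frame).

Lemma frame_det_neq0 : det (e 0%N) (e 1%N) (e 2%N) != 0.
Proof.
have [c c_neq0 [-> _]] := det_coord frame det_alt dimV det_neq0.
by rewrite pairing_detE !(frame_pairing frame) !(mulr0, mul0r, subr0, addr0, mulr1).
Qed.
Lemma frame_dual_det_neq0 : dual_det det (eps 0%N) (eps 1%N) (eps 2%N) != 0.
Proof.
have [c c_neq0 [_ ->]] := det_coord frame det_alt dimV det_neq0.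
by rewrite pairing_detE !(frame_pairing frame) !(mulr0, mul0r, subr0, addr0, mulr1, mul1r) invr_eq0.
Qed.

Ltac evaluate := rewrite !evaluateE /=.

Lemma jacobi_SSS : (forall d d' d'', J (tS d) (tS d') (tS d'') = 0) <-> is_lie_bracket (sbr X).
Proof.
rewrite (lie_bracketP (bilinearP _) (sbr_anticomm X)) //.
by split=> H d d' d''; have := H d d' d''; rewrite jacobiator_SSS.
Qed.

Lemma jacobi_SSA : (forall d d' x a, J (tS d) (tS d') (tA x a) = 0) <->
  is_lie_module (sbr X) (sA X).
Proof.
split=> [H|[_ H] d d' x a]; last by apply/jacobiator_SSA => f v; rewrite H subrr scaler0.
split=> [|d d' a]; first exact: bilinearP.
have := (jacobiator_SSA _ _ _ _).1 (H d d' (E 0 1) a) (eps 0%N) (e 1%N).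
evaluate => H0; by_combination (1 : F) H0.
Qed.

Lemma jacobi_SSB : (forall d d' u b, J (tS d) (tS d') (tB u b) = 0) <->
  is_lie_module (sbr X) (sB X).
Proof.
split=> [H|[_ H] d d' u b]; last by apply/jacobiator_SSB => f; rewrite H subrr scaler0.
split=> [|d d' b]; first exact: bilinearP.
have := (jacobiator_SSB _ _ _ _).1 (H d d' (e 0%N) b) (eps 0%N).
evaluate => H0; by_combination (-1 : F) H0.
Qed.

Lemma jacobi_SSC : (forall d d' g c, J (tS d) (tS d') (tC g c) = 0) <->
  is_lie_module (sbr X) (sC X).
Proof.
split=> [H|[_ H] d d' g c]; last by apply/jacobiator_SSC => v; rewrite H subrr scaler0.
split=> [|d d' c]; first exact: bilinearP.
have := (jacobiator_SSC _ _ _ _).1 (H d d' (eps 0%N) c) (e 0%N).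
evaluate => H0; by_combination (-1 : F) H0.
Qed.

Lemma jacobi_SAB : (forall d x a u b, J (tS d) (tA x a) (tB u b) = 0) <->
  s_invariant (sA X) (sB X) (sB X) (lmulB X).
Proof.
split=> [H d a b|H d x a u b]; last by apply/jacobiator_SAB => f; rewrite H subrr scaler0.
have := (jacobiator_SAB _ _ _ _ _).1 (H d (E 0 1) a (e 1%N) b) (eps 0%N).
evaluate => H0; by_combination (1 : F) H0.
Qed.

Lemma jacobi_SAC : (forall d x a g c, J (tS d) (tA x a) (tC g c) = 0) <->
  s_invariant (sC X) (sA X) (sC X) (rmulC X).
Proof.
split=> [H d c a|H d x a g c]; last by apply/jacobiator_SAC => v; rewrite H subrr scaler0.
have := (jacobiator_SAC _ _ _ _ _).1 (H d (E 0 1) a (eps 0%N) c) (e 1%N).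
evaluate => H0; by_combination (-1 : F) H0.
Qed.

Lemma jacobi_SBB : (forall d u1 b1 u2 b2, J (tS d) (tB u1 b1) (tB u2 b2) = 0) <->
  s_invariant (sB X) (sB X) (sC X) (crossB X).
Proof.
split=> [H d b1 b2|H d u1 b1 u2 b2]; last by apply/jacobiator_SBB => v; rewrite H subrr scaler0.
exact: (eq_of_scaled ((jacobiator_SBB _ _ _ _ _).1 (H d _ b1 _ b2) _) frame_det_neq0).
Qed.

Lemma jacobi_SCC : (forall d g1 c1 g2 c2, J (tS d) (tC g1 c1) (tC g2 c2) = 0) <->
  s_invariant (sC X) (sC X) (sB X) (crossC X).
Proof.
split=> [H d c1 c2|H d g1 c1 g2 c2]; last by apply/jacobiator_SCC => f; rewrite H subrr scaler0.
exact: (eq_of_scaled ((jacobiator_SCC _ _ _ _ _).1 (H d _ c1 _ c2) _) frame_dual_det_neq0).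
Qed.

Lemma jacobi_SBC : (forall d u b g c, J (tS d) (tB u b) (tC g c) = 0) <->
  s_invariant (sB X) (sC X) (sA X) (TBC X) /\ s_invariant (sB X) (sC X) (sbr X) (DBC X).
Proof.
split=> [H|[HT HD] d u b g c]; last first.
  by apply/jacobiator_SBC; split=> [f v|]; rewrite ?HT ?HD subrr scaler0.
split=> d b c.
  have [/(_ (eps 0%N) (e 1%N)) + _] := (jacobiator_SBC _ _ _ _ _).1 (H d (e 0%N) b (eps 1%N) c).
  evaluate => H0; by_combination (1 : F) H0.
have [_] := (jacobiator_SBC _ _ _ _ _).1 (H d (e 0%N) b (eps 0%N) c).
evaluate => H0; by_combination (3%:R : F) H0.
Qed.

(** Invariance of the product follows from [E 0 1] and [E 1 2], as their products are [E 0 2] in one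
    order and [0] in the other; that of D on A from [E 0 1] and [E 1 0], which the trace
    form pairs. *)
Lemma jacobi_SAA : (forall d x a y a', J (tS d) (tA x a) (tA y a') = 0) <->
  [/\ s_invariant (sA X) (sA X) (sA X) (circ X), s_invariant (sA X) (sA X) (sA X) (comm X) &
      s_invariant (sA X) (sA X) (sbr X) (DA X)].
Proof.
split=> [H|[Hcirc Hcomm HD] d x a y a']; last first.
  apply/jacobiator_SAA; rewrite HD subrr scaler0; split=> // f v.
  have inv0 p q : derivation_defect d p q = 0.
    rewrite /derivation_defect /altmul linearDr !linearZr_LR Hcirc Hcomm; compare_coefs; ring.
  by rewrite !inv0 subrr !scaler0 !subr0.
have inv0 d p q : sA X d (am p q) = am (sA X d p) q + am p (sA X d q).
  have [/(_ (eps 0%N) (e 2%N)) + _] := (jacobiator_SAA _ _ _ _ _).1 (H d (E 0 1) p (E 1 2) q).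
  evaluate; rewrite /derivation_defect => H0; by_combination (1 : F) H0.
split=> d p q.
- rewrite !circE linearDr !inv0; compare_coefs; ring.
- rewrite !commE linearBr !inv0; compare_coefs; ring.
have [_] := (jacobiator_SAA _ _ _ _ _).1 (H d (E 0 1) p (E 1 0) q).
evaluate => H0; by_combination (3%:R : F) H0.
Qed.

(** The pair [E 0 1], [E 1 2], with product [0] in the other order and orthogonal for the trace form,
    isolates associativity; the pair [E 0 1], [E 1 0], which kills [e 2], isolates D. *)
Lemma jacobi_AAB : (forall x a y a' u b, J (tA x a) (tA y a') (tB u b) = 0) <->
  (forall a a' b, lmulB X a (lmulB X a' b) = lmulB X (am a a') b /\
                  sB X (DA X a a') b = lmulB X (comm X a a') b).
Proof.
split=> [H|H x a y a' u b]; last first.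
  apply/jacobiator_AAB => f; rewrite (H a a' b).1 (H a' a b).1 (H a a' b).2.
  by rewrite !subrr !scaler0 subrr addr0.
move=> a a' b; split.
  have := (jacobiator_AAB _ _ _ _ _ _).1 (H (E 0 1) a (E 1 2) a' (e 2%N) b) (eps 0%N).
  evaluate => H0; by_combination (1 : F) H0.
have := (jacobiator_AAB _ _ _ _ _ _).1 (H (E 0 1) a (E 1 0) a' (e 2%N) b) (eps 2%N).
evaluate => H0; by_combination (- 3%:R : F) H0.
Qed.

Lemma jacobi_AAC : (forall x a y a' g c, J (tA x a) (tA y a') (tC g c) = 0) <->
  (forall a a' c, rmulC X (rmulC X c a) a' = rmulC X c (am a a') /\
                  sC X (DA X a a') c = rmulC X c (comm X a' a)).
Proof.
split=> [H|H x a y a' g c]; last first.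
  apply/jacobiator_AAC => f; rewrite (H a a' c).1 (H a' a c).1 (H a a' c).2 (comm_anticomm X a a').
  by rewrite linearNr addNr !subrr !scaler0 !subr0.
move=> a a' c; split.
  have := (jacobiator_AAC _ _ _ _ _ _).1 (H (E 1 2) a' (E 0 1) a (eps 0%N) c) (e 2%N).
  evaluate => H0; by_combination (1 : F) H0.
have := (jacobiator_AAC _ _ _ _ _ _).1 (H (E 0 1) a (E 1 0) a' (eps 2%N) c) (e 2%N).
rewrite (comm_anticomm X a' a) linearNr.
evaluate => H0; by_combination (- 3%:R : F) H0.
Qed.

(** Each test makes one of the four scalars of [jacobiator_ABC] nonzero, except the last one, which
    also involves the first coefficient, zero by then. *)
Lemma jacobi_ABC : (forall x a u b g c, J (tA x a) (tB u b) (tC g c) = 0) <->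
  (forall a b c,
     am a (TBC X b c) = TBC X (lmulB X a b) c /\
     am (TBC X b c) a = TBC X b (rmulC X c a) /\
     DA X a (TBC X b c) = DBC X (lmulB X a b) c - DBC X b (rmulC X c a) /\
     sA X (DBC X b c) a = comm X (TBC X b c) a).
Proof.
split=> [H a b c|H x a u b g c]; last first.
  have [H1 [H2 [H3 H4]]] := H a b c; apply/jacobiator_ABC; split=> [f v|].
    rewrite H4 -H1 -H2 !commE.
    compare_coefs; ring.
  by rewrite H3; compare_coefs; ring.
have H1 : am a (TBC X b c) = TBC X (lmulB X a b) c.
  have [/(_ (eps 0%N) (e 2%N)) + _] :=
    (jacobiator_ABC _ _ _ _ _ _).1 (H (E 0 1) a (e 1%N) b (eps 2%N) c).
  evaluate => H0; by_combination (1 : F) H0.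
have H2 : am (TBC X b c) a = TBC X b (rmulC X c a).
  have [/(_ (eps 2%N) (e 1%N)) + _] :=
    (jacobiator_ABC _ _ _ _ _ _).1 (H (E 0 1) a (e 2%N) b (eps 0%N) c).
  evaluate => H0; by_combination (- 1 : F) H0.
split=> //; split=> //; split.
  have [_] := (jacobiator_ABC _ _ _ _ _ _).1 (H (E 0 1) a (e 1%N) b (eps 0%N) c).
  evaluate => H0; by_combination (3%:R : F) H0.
have [/(_ (eps 0%N) (e 1%N)) + _] :=
  (jacobiator_ABC _ _ _ _ _ _).1 (H (E 0 1) a (e 1%N) b (eps 1%N) c).
rewrite H1 H2 (comm_anticomm X a); evaluate => H0; by_combination (- 3%:R : F) H0.
Qed.

(** With [x] sending [e 1] to [e 0] and the other basis vectors to [0], and [e 1] taken twice among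
    [u1], [u2], [v], two of the three determinants survive, with opposite signs. *)
Lemma jacobi_ABB : (forall x a u1 b1 u2 b2, J (tA x a) (tB u1 b1) (tB u2 b2) = 0) <->
  (forall a b1 b2, rmulC X (crossB X b1 b2) a = crossB X (lmulB X a b1) b2 /\
                   crossB X (lmulB X a b1) b2 = crossB X b1 (lmulB X a b2)).
Proof.
split=> [H a b1 b2|H x a u1 b1 u2 b2]; last first.
  apply/jacobiator_ABB => v; have [-> ->] := H a b1 b2.
  have tr0 := det_trace frame det_alt dimV det_neq0 (vsval x) u1 u2 v.
  rewrite sl_tr0 mul0r in tr0; rewrite -[RHS](scale0r (- crossB X b1 (lmulB X a b2))) -tr0.
  compare_coefs; ring.
have [k kn0 [detE _]] := det_coord frame det_alt dimV det_neq0.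
have HJ x u1 u2 v := (jacobiator_ABB _ _ _ _ _ _).1 (H x a u1 b1 u2 b2) v.
have H1 := HJ (E 0 1) (e 1%N) (e 1%N) (e 2%N).
have H2 := HJ (E 0 1) (e 1%N) (e 2%N) (e 1%N).
move: H1 H2; rewrite !detE !pairing_detE; evaluate => H1 H2; split.
  by_combination (- k^-1) H2.
by_combination (- k^-1) H1.
Qed.

Lemma jacobi_ACC : (forall x a g1 c1 g2 c2, J (tA x a) (tC g1 c1) (tC g2 c2) = 0) <->
  (forall a c1 c2, lmulB X a (crossC X c1 c2) = crossC X (rmulC X c1 a) c2 /\
                   crossC X (rmulC X c1 a) c2 = crossC X c1 (rmulC X c2 a)).
Proof.
split=> [H a c1 c2|H x a g1 c1 g2 c2]; last first.
  apply/jacobiator_ACC => f; have [-> ->] := H a c1 c2.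
  have tr0 := dual_det_trace frame det_alt dimV det_neq0 (vsval x) g1 g2 f.
  rewrite sl_tr0 mul0r in tr0; rewrite -[RHS](scale0r (crossC X c1 (rmulC X c2 a))) -tr0.
  rewrite /dual_act; compare_coefs; ring.
have [k kn0 [_ dual_detE]] := det_coord frame det_alt dimV det_neq0.
have HJ x g1 g2 f := (jacobiator_ACC _ _ _ _ _ _).1 (H x a g1 c1 g2 c2) f.
have H1 := HJ (E 0 1) (eps 0%N) (eps 0%N) (eps 2%N).
have H2 := HJ (E 0 1) (eps 0%N) (eps 2%N) (eps 0%N).
move: H1 H2; rewrite !dual_detE !pairing_detE; rewrite !dual_actE; evaluate => H1 H2; split.
  by_combination (- k) H2.
by_combination (- k) H1.
Qed.

(** Basis vectors in all three places give the relation for D. With [e 0], [e 1], [e 0] the volume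
    vanishes, and with [v = e 2] only two values of T remain, with opposite signs. *)
Lemma jacobi_BBB : (forall u1 b1 u2 b2 u3 b3, J (tB u1 b1) (tB u2 b2) (tB u3 b3) = 0) <->
  (forall b, DBC X b (crossB X b b) = 0) /\
  symmetric3 (fun b1 b2 b3 => TBC X b1 (crossB X b2 b3)).
Proof.
rewrite (cubic_polarized two_neq0 three_neq0 (bilinearP _) (crossB_sym X) (bilinearP _)).
split=> [H|[HD HT] u1 b1 u2 b2 u3 b3]; last first.
  apply/jacobiator_BBB; rewrite HD scaler0; split=> // f v.
  have [_ _ _ -> ->] := HT b1 b2 b3.
  have cr := det_cramer frame det_alt dimV det_neq0 u1 u2 u3 f v.
  rewrite -!scalerDl.
  rewrite [X in X *: _](_ : _ = 0) ?scale0r //.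
  transitivity (f u1 * det u2 u3 v + f u2 * det u3 u1 v + f u3 * det u1 u2 v
      - det u1 u2 u3 * (f v : F)).
    by field.
  by rewrite cr subrr.
have [k kn0 [detE _]] := det_coord frame det_alt dimV det_neq0.
split=> [b1 b2 b3|].
  have [_] := (jacobiator_BBB _ _ _ _ _ _).1 (H (e 0%N) b1 (e 1%N) b2 (e 2%N) b3).
  rewrite !detE !pairing_detE; evaluate => H0.
  by_combination (3%:R / k) H0.
apply: symmetric3_cyclic => [b1 b2 b3|b1 b2 b3]; first by rewrite (crossB_sym X b3).
have [/(_ (eps 0%N) (e 2%N)) + _] :=
  (jacobiator_BBB _ _ _ _ _ _).1 (H (e 0%N) b2 (e 1%N) b3 (e 0%N) b1).
rewrite !detE !pairing_detE; evaluate => H0.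
by_combination (- k^-1) H0.
Qed.

Lemma jacobi_CCC : (forall g1 c1 g2 c2 g3 c3, J (tC g1 c1) (tC g2 c2) (tC g3 c3) = 0) <->
  (forall c, DBC X (crossC X c c) c = 0) /\
  symmetric3 (fun c1 c2 c3 => TBC X (crossC X c1 c2) c3).
Proof.
have bD : is_bilinear (fun c b => DBC X b c) by have [? ?] := bilinearP (DBC X).
rewrite (cubic_polarized two_neq0 three_neq0 (bilinearP _) (crossC_sym X) bD).
split=> [H|[HD HT] g1 c1 g2 c2 g3 c3]; last first.
  apply/jacobiator_CCC; rewrite HD scaler0; split=> // f v.
  have [_ _ _ E1 E2] := HT c1 c2 c3; rewrite E1 E2.
  have cr := dual_det_cramer frame det_alt dimV det_neq0 g1 g2 g3 v f.
  rewrite -scaleNr -!scalerBl.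
  rewrite [X in X *: _](_ : _ = 0) ?scale0r //.
  transitivity (dual_det det g1 g2 g3 * (f v : F) - ((g1 v : F) * dual_det det g2 g3 f
      + (g2 v : F) * dual_det det g3 g1 f + (g3 v : F) * dual_det det g1 g2 f)).
    by field.
  by rewrite cr subrr.
have [k kn0 [_ dual_detE]] := det_coord frame det_alt dimV det_neq0.
split=> [c1 c2 c3|].
  have [_] := (jacobiator_CCC _ _ _ _ _ _).1 (H (eps 0%N) c1 (eps 1%N) c2 (eps 2%N) c3).
  rewrite !dual_detE !pairing_detE; evaluate => H0.
  by_combination (- 3%:R * k) H0.
have cyc c1 c2 c3 : TBC X (crossC X c2 c3) c1 = TBC X (crossC X c1 c2) c3.
  have [/(_ (eps 2%N) (e 0%N)) + _] :=
    (jacobiator_CCC _ _ _ _ _ _).1 (H (eps 0%N) c1 (eps 1%N) c2 (eps 0%N) c3).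
  rewrite !dual_detE !pairing_detE; evaluate => H0.
  by_combination (k) H0.
apply: symmetric3_cyclic => // c1 c2 c3.
by rewrite (crossC_sym X c1) (cyc c2 c3 c1) cyc.
Qed.

(** The two brackets in [jacobiator_BBC] are exchanged by the symmetry of [×], and [g = eps 0] selects
    one of them. *)
Lemma jacobi_BBC : (forall u1 b1 u2 b2 g c, J (tB u1 b1) (tB u2 b2) (tC g c) = 0) <->
  (forall b1 b2 c, crossC X (crossB X b1 b2) c =
      - (3%:R^-1 *: lmulB X (TBC X b1 c) b2) + 3%:R^-1 *: sB X (DBC X b1 c) b2
      - lmulB X (TBC X b2 c) b1).
Proof.
split=> [H b1 b2 c|H u1 b1 u2 b2 g c]; last first.
  apply/jacobiator_BBC => f; rewrite {2}H (crossB_sym X b1) H; compare_coefs; ring.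
have := (jacobiator_BBC _ _ _ _ _ _).1 (H (e 0%N) b1 (e 1%N) b2 (eps 0%N) c) (eps 1%N).
evaluate => H0; by_combination (- 1 : F) H0.
Qed.

Lemma jacobi_BCC : (forall u b g1 c1 g2 c2, J (tB u b) (tC g1 c1) (tC g2 c2) = 0) <->
  (forall b c1 c2, crossB X b (crossC X c1 c2) =
      - rmulC X c2 (TBC X b c1) - 3%:R^-1 *: rmulC X c1 (TBC X b c2)
      - 3%:R^-1 *: sC X (DBC X b c2) c1).
Proof.
split=> [H b c1 c2|H u b g1 c1 g2 c2]; last first.
  apply/jacobiator_BCC => f; rewrite {1}H (crossC_sym X c1) H; compare_coefs; ring.
have := (jacobiator_BCC _ _ _ _ _ _).1 (H (e 0%N) b (eps 1%N) c1 (eps 0%N) c2) (e 1%N).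
evaluate => H0; by_combination (1 : F) H0.
Qed.

(** The linearized form of alternativity, which is the one that the Jacobiator provides. *)
Lemma alternative_associator : is_alternative am <->
  (forall p q r : A, associator q p r = - associator p q r) /\
  (forall p q r : A, associator p r q = - associator p q r).
Proof.
have altE := altmulE.
split=> [alt|[swl swr] p q]; last first.
  have half (t : A) : t = - t -> t = 0.
    by move=> t0; by_combination (2%:R^-1 : F) (etrans (congr1 (fun w => t + w) t0) (subrr t)).
  split; first by have /eqP := half _ (swl p p q); rewrite subr_eq0 => /eqP.
  by have /eqP := half _ (swr q p p); rewrite subr_eq0 => /eqP.
split=> p q r.
  have [E12 _] := alt (p + q) r; have [E1 _] := alt p r; have [E2 _] := alt q r.
  have E0 : associator (p + q) (p + q) r - associator p p r - associator q q r = 0.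
    by rewrite /associator E12 E1 E2 !subrr ?subr0.
  move: E0; rewrite /associator !altE => E0; by_combination (1 : F) E0.
have [_ E12] := alt (q + r) p; have [_ E1] := alt q p; have [_ E2] := alt r p.
have E0 : associator p (q + r) (q + r) - associator p q q - associator p r r = 0.
  by rewrite /associator E12 E1 E2 !subrr ?subr0.
move: E0; rewrite /associator !altE => E0; by_combination (1 : F) E0.
Qed.

(** The [(0, 2)] entry for [x = E 0 1], [y = E 1 2] and [z] diagonal gives a relation between three
    associators whose coefficients are the diagonal entries of [z]; two choices of [z] make the
    associator alternating. The entry of [(E 0 2, E 0 1, E 1 0)], where [E 0 1] and [E 1 0] are
    paired, gives the action of D, and the cycle [E 0 1], [E 1 2], [E 2 0], whose product has nonzero
    trace in one order only, gives the cyclic relation. Conversely, when the associator is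
    alternating all terms are multiples of a single one, and the factor is the polarized
    Cayley-Hamilton identity. *)
Lemma jacobi_AAA : (forall x a y b z c, J (tA x a) (tA y b) (tA z c) = 0) <->
  is_alternative am /\
   (forall a1 a2 a3, DA X a1 (am a2 a3) + DA X a2 (am a3 a1) + DA X a3 (am a1 a2) = 0) /\
   (forall a1 a2 a3, sA X (DA X a1 a2) a3 =
      comm X (comm X a1 a2) a3 + 3%:R *: (am (am a1 a3) a2 - am a1 (am a3 a2))).
Proof.
rewrite alternative_associator; split=> [H|[[swl swr] [HD Hd]] x a y b z c].
  have HJ x y z f v a b c := ((jacobiator_AAA _ _ _ _ _ _).1 (H x a y b z c)).1 f v.
  have swr p q r : associator p r q = - associator p q r.
    have := HJ (E 0 1) (E 1 2) (E 0 0) (eps 0%N) (e 2%N) p q r.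
    have := HJ (E 0 1) (E 1 2) (E 1 1) (eps 0%N) (e 2%N) p q r.
    evaluate => H1 H0.
    (* The diagonals of z are (2, -1, -1)/3 and (-1, 2, -1)/3. *)
    apply: (eq_of_zero2 (k1 := 2%:R) (k2 := 1) H1 H0); compare_coefs; field; nonzero.
  have cyc p q r : associator r p q = associator p q r.
    have := HJ (E 0 1) (E 1 2) (E 0 0) (eps 0%N) (e 2%N) p q r.
    rewrite (swr p q r); evaluate => H0; by_combination (- (3%:R / 2%:R) : F) H0.
  have swl p q r : associator q p r = - associator p q r.
    by rewrite -(cyc q p r) swr cyc -(cyc p q r) -(cyc r p q).
  split=> //; split=> p q r.
    have [_] := (jacobiator_AAA _ _ _ _ _ _).1 (H (E 0 1) p (E 1 2) q (E 2 0) r).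
    rewrite /cyclic_DA; evaluate => H0; by_combination (3%:R : F) H0.
  have := HJ (E 0 2) (E 0 1) (E 1 0) (eps 0%N) (e 2%N) r p q.
  evaluate; rewrite -[am (am p r) q - _]/(associator p r q) (swr p q r) /nested_action.
  rewrite (comm_anticomm X r (comm X p q)) => H0.
  by_combination (- 3%:R : F) H0.
have cyc p q r : associator q r p = associator p q r by rewrite swr swl opprK.
apply/jacobiator_AAA; split=> [f v|]; last by rewrite /cyclic_DA !HD !scaler0 subrr.
have cyc_commE p q r : cyclic_comm p q r = - 3%:R *: associator p q r.
  transitivity (- (associator p q r + associator q r p + associator r p q)).
    rewrite /cyclic_comm /associator !commE; compare_coefs; ring.
  by rewrite (cyc q r p) (cyc p q r); compare_coefs; ring.
have nestedE p q r : nested_action p q r = - 3%:R *: associator p q r.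
  rewrite /nested_action Hd (comm_anticomm X p) -[am (am q p) r - _]/(associator q p r) swl.
  compare_coefs; ring.
rewrite !cyc_commE !nestedE (cyc b c a) (swl b c a) (swl a b c) (swr a b c) (cyc a b c).
have := congr1 (fun w : 'End(V) => (f (w v) : F))
  (cayley_hamilton3 frame (sl_tr0 x) (sl_tr0 y) (sl_tr0 z)).
rewrite !(add_lfunE, scale_lfunE, comp_lfunE, id_lfunE) !(@pushE F V) => /eqP.
rewrite -subr_eq0 => /eqP ch.
rewrite -[RHS](scale0r (- associator a b c)) -ch /sl_form; compare_coefs; field; nonzero.
Qed.

Definition type_rank (g : generator) : nat :=
  match g with GenS _ => 0 | GenA _ _ => 1 | GenB _ _ => 2 | GenC _ _ => 3 end.

Lemma lie_bracket_generators : is_lie_bracket (bracket det X) <->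
  (forall g h k : generator, (type_rank g <= type_rank h)%N -> (type_rank h <= type_rank k)%N ->
     J (gen g) (gen h) (gen k) = 0).
Proof.
rewrite -gbracketE (lie_bracketP gbracket_bilinear brC two_neq0); split=> [J0|J0] .
  by move=> *; apply: J0.
apply: (jacobiator_spanned gbracket_bilinear gen_spanned).
apply: (sorted_triples (ty := type_rank)) => [g h k|g h k|g h k]; last exact: J0.
  by move=> Jghk; rewrite (jacobiator_cycle gbracket (gen g)).
by move=> Jghk; rewrite (jacobiator_swap gbracket_bilinear brC (gen g)) Jghk oppr0.
Qed.

End GradedJacobi.

Theorem theorem2p1 (F : fieldType) (V : vectType F) (A B C s : lmodType F)
    (det : V -> V -> V -> F) (X : coord_data A B C s)
    (char2 : 2%N \notin [pchar F]) (char3 : 3%N \notin [pchar F])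
    (dimV : \dim {:V} = 3%N)
    (det_alt : alternating3 det)
    (det_neq0 : exists v1 v2 v3, det v1 v2 v3 != 0) :
  is_lie_bracket (bracket det X) <->
  (* (0) *)
  (is_lie_bracket (sbr X) /\
   is_lie_module (sbr X) (sA X) /\
   is_lie_module (sbr X) (sB X) /\
   is_lie_module (sbr X) (sC X) /\
   s_invariant (sA X) (sA X) (sA X) (circ X) /\
   s_invariant (sA X) (sA X) (sA X) (comm X) /\
   s_invariant (sA X) (sA X) (sbr X) (DA X) /\
   s_invariant (sA X) (sB X) (sB X) (lmulB X) /\
   s_invariant (sC X) (sA X) (sC X) (rmulC X) /\
   s_invariant (sB X) (sC X) (sA X) (TBC X) /\
   s_invariant (sB X) (sC X) (sbr X) (DBC X) /\
   s_invariant (sB X) (sB X) (sC X) (crossB X) /\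
   s_invariant (sC X) (sC X) (sB X) (crossC X)) /\
  (* (1) *)
  (is_alternative (altmul X) /\
   (forall a1 a2 a3, DA X a1 (altmul X a2 a3) + DA X a2 (altmul X a3 a1)
                     + DA X a3 (altmul X a1 a2) = 0) /\
   (forall a1 a2 a3, sA X (DA X a1 a2) a3 =
      comm X (comm X a1 a2) a3
      + 3%:R *: (altmul X (altmul X a1 a3) a2 - altmul X a1 (altmul X a3 a2)))) /\
  (* (2) *)
  (forall a1 a2 b c,
     lmulB X a1 (lmulB X a2 b) = lmulB X (altmul X a1 a2) b /\
     rmulC X (rmulC X c a1) a2 = rmulC X c (altmul X a1 a2) /\
     sB X (DA X a1 a2) b = lmulB X (comm X a1 a2) b /\
     sC X (DA X a1 a2) c = rmulC X c (comm X a2 a1)) /\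
  (* (3) *)
  (forall a b c,
     altmul X a (TBC X b c) = TBC X (lmulB X a b) c /\
     altmul X (TBC X b c) a = TBC X b (rmulC X c a) /\
     DA X a (TBC X b c) = DBC X (lmulB X a b) c - DBC X b (rmulC X c a) /\
     sA X (DBC X b c) a = comm X (TBC X b c) a) /\
  (* (4) *)
  ((forall a b1 b2,
      rmulC X (crossB X b1 b2) a = crossB X (lmulB X a b1) b2 /\
      crossB X (lmulB X a b1) b2 = crossB X b1 (lmulB X a b2)) /\
   (forall a c1 c2,
      lmulB X a (crossC X c1 c2) = crossC X (rmulC X c1 a) c2 /\
      crossC X (rmulC X c1 a) c2 = crossC X c1 (rmulC X c2 a))) /\
  (* (5) *)
  ((forall b, DBC X b (crossB X b b) = 0) /\
   (forall c, DBC X (crossC X c c) c = 0) /\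
   symmetric3 (fun b1 b2 b3 => TBC X b1 (crossB X b2 b3)) /\
   symmetric3 (fun c1 c2 c3 => TBC X (crossC X c1 c2) c3)) /\
  (* (6) *)
  ((forall b1 b2 c,
      crossC X (crossB X b1 b2) c =
      - (3%:R^-1 *: lmulB X (TBC X b1 c) b2) + 3%:R^-1 *: sB X (DBC X b1 c) b2
      - lmulB X (TBC X b2 c) b1) /\
   (forall b c1 c2,
      crossB X b (crossC X c1 c2) =
      - rmulC X c2 (TBC X b c1) - 3%:R^-1 *: rmulC X c1 (TBC X b c2)
      - 3%:R^-1 *: sC X (DBC X b c2) c1)).
Proof.
have [e [eps frame]] := dual_bases3_exist dimV.
have cSSS := jacobi_SSS X char2 det_alt.
have cSSA := jacobi_SSA X char3 dimV det_alt frame.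
have cSSB := jacobi_SSB X det_alt frame.
have cSSC := jacobi_SSC X det_alt frame.
have cSAA := jacobi_SAA X char2 char3 dimV det_alt frame.
have cSAB := jacobi_SAB X char3 dimV det_alt frame.
have cSAC := jacobi_SAC X char3 dimV det_alt frame.
have cSBB := jacobi_SBB X dimV det_alt det_neq0 frame.
have cSBC := jacobi_SBC X char3 dimV det_alt frame.
have cSCC := jacobi_SCC X dimV det_alt det_neq0 frame.
have cAAA := jacobi_AAA X char2 char3 dimV det_alt frame.
have cAAB := jacobi_AAB X char2 char3 dimV det_alt frame.
have cAAC := jacobi_AAC X char2 char3 dimV det_alt frame.
have cABB := jacobi_ABB X char3 dimV det_alt det_neq0 frame.
have cABC := jacobi_ABC X char2 char3 dimV det_alt frame.
have cACC := jacobi_ACC X char3 dimV det_alt det_neq0 frame.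
have cBBB := jacobi_BBB X char2 char3 dimV det_alt det_neq0 frame.
have cBBC := jacobi_BBC X char3 dimV det_alt det_neq0 frame.
have cBCC := jacobi_BCC X char3 dimV det_alt det_neq0 frame.
have cCCC := jacobi_CCC X char2 char3 dimV det_alt det_neq0 frame.
rewrite (lie_bracket_generators X char2 det_alt); split=> [J0|].
  pose gA (x : subvs_of (sl V)) (a : A) := GenA B C s x a.
  pose gB (u : V) (b : B) := GenB A C s u b.
  pose gC (f : dual V) (c : C) := GenC A B s f c.
  pose gS (d : s) := GenS V A B C d.
  have hSSS := cSSS.1 (fun d0 d1 d2 => J0 (gS d0) (gS d1) (gS d2) isT isT).
  have hSSA := cSSA.1 (fun d0 d1 x2 a2 => J0 (gS d0) (gS d1) (gA x2 a2) isT isT).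
  have hSSB := cSSB.1 (fun d0 d1 u2 b2 => J0 (gS d0) (gS d1) (gB u2 b2) isT isT).
  have hSSC := cSSC.1 (fun d0 d1 f2 c2 => J0 (gS d0) (gS d1) (gC f2 c2) isT isT).
  have [circ_inv comm_inv DA_inv] := cSAA.1 (fun d0 x1 a1 x2 a2 => J0 (gS d0) (gA x1 a1) (gA x2 a2) isT isT).
  have hSAB := cSAB.1 (fun d0 x1 a1 u2 b2 => J0 (gS d0) (gA x1 a1) (gB u2 b2) isT isT).
  have hSAC := cSAC.1 (fun d0 x1 a1 f2 c2 => J0 (gS d0) (gA x1 a1) (gC f2 c2) isT isT).
  have hSBB := cSBB.1 (fun d0 u1 b1 u2 b2 => J0 (gS d0) (gB u1 b1) (gB u2 b2) isT isT).
  have [T_inv DBC_inv] := cSBC.1 (fun d0 u1 b1 f2 c2 => J0 (gS d0) (gB u1 b1) (gC f2 c2) isT isT).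
  have hSCC := cSCC.1 (fun d0 f1 c1 f2 c2 => J0 (gS d0) (gC f1 c1) (gC f2 c2) isT isT).
  have hAAA := cAAA.1 (fun x0 a0 x1 a1 x2 a2 => J0 (gA x0 a0) (gA x1 a1) (gA x2 a2) isT isT).
  have hAAB := cAAB.1 (fun x0 a0 x1 a1 u2 b2 => J0 (gA x0 a0) (gA x1 a1) (gB u2 b2) isT isT).
  have hAAC := cAAC.1 (fun x0 a0 x1 a1 f2 c2 => J0 (gA x0 a0) (gA x1 a1) (gC f2 c2) isT isT).
  have hABB := cABB.1 (fun x0 a0 u1 b1 u2 b2 => J0 (gA x0 a0) (gB u1 b1) (gB u2 b2) isT isT).
  have hABC := cABC.1 (fun x0 a0 u1 b1 f2 c2 => J0 (gA x0 a0) (gB u1 b1) (gC f2 c2) isT isT).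
  have hACC := cACC.1 (fun x0 a0 f1 c1 f2 c2 => J0 (gA x0 a0) (gC f1 c1) (gC f2 c2) isT isT).
  have [DB_diag TB_sym] := cBBB.1 (fun u0 b0 u1 b1 u2 b2 => J0 (gB u0 b0) (gB u1 b1) (gB u2 b2) isT isT).
  have hBBC := cBBC.1 (fun u0 b0 u1 b1 f2 c2 => J0 (gB u0 b0) (gB u1 b1) (gC f2 c2) isT isT).
  have hBCC := cBCC.1 (fun u0 b0 f1 c1 f2 c2 => J0 (gB u0 b0) (gC f1 c1) (gC f2 c2) isT isT).
  have [DC_diag TC_sym] := cCCC.1 (fun f0 c0 f1 c1 f2 c2 => J0 (gC f0 c0) (gC f1 c1) (gC f2 c2) isT isT).
  split; first by do ![split=> //].
  split=> //; split.
    by move=> a1 a2 b c; have [? ?] := hAAB a1 a2 b; have [? ?] := hAAC a1 a2 c.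
  by do ![split=> //].
case=> [[hSSS [hSSA [hSSB [hSSC [hcirc [hcomm [hDA [hAB [hCA [hT [hDBC [hBB hCC]]]]]]]]]]]]].
case=> [hAAA [h2 [hABC [[hABB hACC] [[hDB [hDC [hTB hTC]]] [hBBC hBCC]]]]]].
have hAAB a1 a2 b : lmulB X a1 (lmulB X a2 b) = lmulB X (altmul X a1 a2) b /\
    sB X (DA X a1 a2) b = lmulB X (comm X a1 a2) b.
  by have [? [_ [? _]]] := h2 a1 a2 b 0.
have hAAC a1 a2 c : rmulC X (rmulC X c a1) a2 = rmulC X c (altmul X a1 a2) /\
    sC X (DA X a1 a2) c = rmulC X c (comm X a2 a1).
  by have [_ [? [_ ?]]] := h2 a1 a2 0 c.
case=> [x a|u b|f c|d] [y a'|u' b'|f' c'|d'] [z a''|u'' b''|f'' c''|d''] // _ _.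
- exact: cAAA.2.
- exact: cAAB.2.
- exact: cAAC.2.
- exact: cABB.2.
- exact: cABC.2.
- exact: cACC.2.
- exact: (cBBB.2 (conj hDB hTB)).
- exact: cBBC.2.
- exact: cBCC.2.
- exact: (cCCC.2 (conj hDC hTC)).
- exact: (cSAA.2 (And3 hcirc hcomm hDA)).
- exact: cSAB.2.
- exact: cSAC.2.
- exact: cSBB.2.
- exact: (cSBC.2 (conj hT hDBC)).
- exact: cSCC.2.
- exact: cSSA.2.
- exact: cSSB.2.
- exact: cSSC.2.
- exact: cSSS.2.
Qed.
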